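(* Let $A$ be a left-artinian ring and let $(\tilde{\mathcal A},v,\epsilon)$ be a graded cover of the category $A\text{-Modf}$ of finitely generated left $A$-modules. Then there exists a $\mathbb Z$-grading on the ring $A$, the corresponding graded ring being denoted $\tilde A$, such that the graded cover $\tilde A\text{-Modf}^{\mathbb Z}$ of $A\text{-Modf}$ is cover-equivalent to $(\tilde{\mathcal A},v,\epsilon)$.
   Context: An artinian category is an abelian category in which each object has finite length. A graded cover of an artinian category $\mathcal A$ is a triple $(\tilde{\mathcal A},v,\epsilon)$ consisting of an abelian category $\tilde{\mathcal A}$ equipped with a strict automorphism $[1]$ (with $i$-th power $[i]$, $i\in\mathbb Z$), an exact functor $v:\tilde{\mathcal A}\to\mathcal A$ and a natural isomorphism $\epsilon:v\Rightarrow v[1]$, such that: (1) for all $M,N\in\tilde{\mathcal A}$ the pair $(v,\epsilon)$ induces an isomorphism $\bigoplus_{i\in\mathbb Z}\tilde{\mathcal A}(M,N[i])\to\mathcal A(vM,vN)$ (apply $v$ and identify $v(N[i])$ with $vN$ via iterates of $\epsilon^{\pm1}$); (2) given $M\in\mathcal A$, $N\in\tilde{\mathcal A}$ and an epimorphism $M\twoheadrightarrow vN$, there exist $P\in\tilde{\mathcal A}$ and an epimorphism $vP\twoheadrightarrow M$ such that the composition $vP\to vN$ comes (via $v$) from a morphism $P\to N$ in $\tilde{\mathcal A}$. No positivity condition is imposed on $\mathbb Z$-gradings of rings. For a $\mathbb Z$-grading on $A$ with graded ring $\tilde A$, $\tilde A\text{-Modf}^{\mathbb Z}$ is the category of finitely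 generated $\mathbb Z$-graded left $\tilde A$-modules with morphisms homogeneous of degree $0$, with shift $(M[i])_j=M_{i+j}$; together with the functor $v$ forgetting the grading and the evident $\epsilon$ it is a graded cover of $A\text{-Modf}$. Cover-equivalence: let $(\tilde{\mathcal A},\tilde v,\tilde\epsilon)$ and $(\hat{\mathcal A},\hat v,\hat\epsilon)$ be graded covers of $\mathcal A$. A cover-equivalence from the first to the second is a triple $(F,\pi,\epsilon)$ with $F:\tilde{\mathcal A}\to\hat{\mathcal A}$ an additive functor and $\epsilon:[1]F\Rightarrow F[1]$, $\pi:\hat vF\Rightarrow\tilde v$ natural isomorphisms such that the two natural isomorphisms $\hat vF\overset{\hat\epsilon}{\Rightarrow}\hat v[1]F\overset{\epsilon}{\Rightarrow}\hat vF[1]\overset{\pi}{\Rightarrow}\tilde v[1]$ and $\hat vF\overset{\pi}{\Rightarrow}\tilde v\overset{\tilde\epsilon}{\Rightarrow}\tilde v[1]$ coincide. Two graded covers are cover-equivalent if there is a cover-equivalence from one to the other. *)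

(* Defs.v *)
From HB Require Import structures.
From mathcomp Require Import all_boot all_order all_algebra.
From mathcomp Require Import all_classical.
Set Implicit Arguments.
Unset Strict Implicit.
Unset Printing Implicit Defensive.
Import GRing.Theory.
Local Open Scope ring_scope.

Reserved Notation "g \oc f" (at level 40, left associativity, format "g  \oc  f").
Reserved Notation "G \of F" (at level 40, left associativity, format "G  \of  F").

Record preadditive := Preadditive {
  obj :> Type;
  hom : obj -> obj -> zmodType;
  idm : forall X, hom X X;
  comp : forall X Y Z, hom Y Z -> hom X Y -> hom X Z;
  compA : forall W X Y Z (h : hom Y Z) (g : hom X Y) (f : hom W X),
    comp h (comp g f) = comp (comp h g) f;
  comp1m : forall X Y (f : hom X Y), comp (idm Y) f = f;
  compm1 : forall X Y (f : hom X Y), comp f (idm X) = f;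
  compDl : forall X Y Z (g g' : hom Y Z) (f : hom X Y),
    comp (g + g') f = comp g f + comp g' f;
  compDr : forall X Y Z (g : hom Y Z) (f f' : hom X Y),
    comp g (f + f') = comp g f + comp g f' }.

Arguments hom {p} X Y.
Arguments idm {p} X.
Notation "g \oc f" := (comp g f).

Definition eqm (C : preadditive) (X Y : C) (e : X = Y) : hom X Y :=
  match e in _ = Z return hom X Z with erefl => idm X end.

Section Limits.
Variable C : preadditive.
Implicit Types X Y Z K Q : C.

Definition monic X Y (f : hom X Y) : Prop :=
  forall W (g h : hom W X), f \oc g = f \oc h -> g = h.

Definition epic X Y (f : hom X Y) : Prop :=
  forall Z (g h : hom Y Z), g \oc f = h \oc f -> g = h.

Definition is_zero_obj Z : Prop :=
  forall X, (forall f : hom X Z, f = 0) /\ (forall f : hom Z X, f = 0).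

Definition is_biproduct X Y Z (i : hom X Z) (j : hom Y Z)
    (p : hom Z X) (q : hom Z Y) : Prop :=
  [/\ p \oc i = idm X, q \oc j = idm Y, p \oc j = 0, q \oc i = 0
    & i \oc p + j \oc q = idm Z].

Definition is_kernel K X Y (k : hom K X) (f : hom X Y) : Prop :=
  f \oc k = 0 /\
  forall T (t : hom T X), f \oc t = 0 -> exists! u : hom T K, k \oc u = t.

Definition is_cokernel X Y Q (q : hom Y Q) (f : hom X Y) : Prop :=
  q \oc f = 0 /\
  forall T (t : hom Y T), t \oc f = 0 -> exists! u : hom Q T, u \oc q = t.

(* 0 -> X -> Y -> Z -> 0 is exact. *)
Definition short_exact X Y Z (f : hom X Y) (g : hom Y Z) : Prop :=
  is_kernel f g /\ is_cokernel g f.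

End Limits.

Record abelian (C : preadditive) : Prop := Abelian {
  ab_zero : exists Z : C, is_zero_obj Z;
  ab_biproduct : forall X Y : C, exists (Z : C) (i : hom X Z) (j : hom Y Z)
    (p : hom Z X) (q : hom Z Y), is_biproduct i j p q;
  ab_kernel : forall (X Y : C) (f : hom X Y),
    exists (K : C) (k : hom K X), is_kernel k f;
  ab_cokernel : forall (X Y : C) (f : hom X Y),
    exists (Q : C) (q : hom Y Q), is_cokernel q f;
  ab_monic : forall (X Y : C) (f : hom X Y), monic f ->
    exists (Z : C) (g : hom Y Z), is_kernel f g;
  ab_epic : forall (X Y : C) (f : hom X Y), epic f ->
    exists (W : C) (g : hom W X), is_cokernel f g }.

Record functor (C D : preadditive) := Functor {
  fob :> C -> D;
  fmap : forall X Y, hom X Y -> hom (fob X) (fob Y);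
  fmap1 : forall X, fmap (idm X) = idm (fob X);
  fmapM : forall X Y Z (g : hom Y Z) (f : hom X Y),
    fmap (g \oc f) = fmap g \oc fmap f }.

Arguments fmap {C D} F {X Y} f : rename.

Definition additive_functor (C D : preadditive) (F : functor C D) : Prop :=
  forall (X Y : C) (f g : hom X Y), fmap F (f + g) = fmap F f + fmap F g.

Definition exact_functor (C D : preadditive) (F : functor C D) : Prop :=
  additive_functor F /\
  forall (X Y Z : C) (f : hom X Y) (g : hom Y Z),
    short_exact f g -> short_exact (fmap F f) (fmap F g).

Definition id_functor (C : preadditive) : functor C C :=
  @Functor C C id (fun _ _ f => f) (fun _ => erefl) (fun _ _ _ _ _ => erefl).

Section CompFunctor.
Variables (C D E : preadditive) (G : functor D E) (F : functor C D).

Fact comp_functor1 X : fmap G (fmap F (idm X)) = idm (G (F X)).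
Proof. by rewrite !fmap1. Qed.

Fact comp_functorM X Y Z (g : hom Y Z) (f : hom X Y) :
  fmap G (fmap F (g \oc f)) = fmap G (fmap F g) \oc fmap G (fmap F f).
Proof. by rewrite !fmapM. Qed.

Definition comp_functor : functor C E :=
  @Functor C E (fun X => G (F X)) (fun _ _ f => fmap G (fmap F f))
    comp_functor1 comp_functorM.

End CompFunctor.

Notation "G \of F" := (comp_functor G F).

Lemma functor_eq (C D : preadditive) (F G : functor C D)
    (e : forall X, F X = G X) :
  (forall X Y (f : hom X Y), eqm (e Y) \oc fmap F f = fmap G f \oc eqm (e X)) ->
  F = G.
Proof.
case: F e => F0 F1 F2 F3; case: G => G0 G1 G2 G3 /= e.
have E : F0 = G0 by apply: funext.
case: _ / E in G1 G2 G3 e *.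
have -> : e = fun=> erefl by apply: Prop_irrelevance.
move=> /= H; have E1 : F1 = G1.
  apply: functional_extensionality_dep => X.
  apply: functional_extensionality_dep => Y.
  by apply: funext => f; rewrite -[LHS]comp1m H compm1.
case: _ / E1 in G2 G3 H *.
by congr Functor; apply: Prop_irrelevance.
Qed.

Record nat_iso (C D : preadditive) (F G : functor C D) := NatIso {
  nt :> forall X, hom (F X) (G X);
  nt_inv : forall X, hom (G X) (F X);
  ntK : forall X, nt_inv X \oc nt X = idm (F X);
  ntVK : forall X, nt X \oc nt_inv X = idm (G X);
  nt_nat : forall X Y (f : hom X Y), nt Y \oc fmap F f = fmap G f \oc nt X }.

Record automorphism (C : preadditive) := Automorphism {
  aut :> functor C C;
  aut_inv : functor C C;
  autK : aut_inv \of aut = id_functor C;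
  autVK : aut \of aut_inv = id_functor C }.

Definition aut_pow (C : preadditive) (S : automorphism C) (i : int) (X : C) : C :=
  match i with
  | Posz n => iter n S X
  | Negz n => iter n.+1 (aut_inv S) X
  end.

(* A triple as in the definition of a graded cover, without its axioms. *)
Record cover_data (B : preadditive) := CoverData {
  cv_cat : preadditive;
  cv_shift : automorphism cv_cat;
  cv_fun : functor cv_cat B;
  cv_eps : nat_iso cv_fun (cv_fun \of cv_shift) }.

Section GradedCover.
Variables (B : preadditive) (X : cover_data B).
Let C := cv_cat X.
Let S := cv_shift X.
Let v := cv_fun X.
Let eps := cv_eps X.

Fixpoint unshift_pos (N : C) (n : nat) : hom (v (iter n S N)) (v N) :=
  match n with
  | 0 => idm (v N)
  | m.+1 => unshift_pos N m \oc nt_inv eps (iter m S N)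
  end.

(* For Y = N[-m], the m-th factor v(Y[-1]) -> v(Y[-1][1]) = v(Y) is eps at
   Y[-1], followed by v of the identity Y[-1][1] = Y. *)
Fixpoint unshift_neg (N : C) (n : nat) :
    hom (v (iter n (aut_inv S) N)) (v N) :=
  match n with
  | 0 => idm (v N)
  | m.+1 =>
    let Y := iter m (aut_inv S) N in
    let e : S (aut_inv S Y) = Y :=
      congr1 (fun F : functor C C => F Y) (autVK S) in
    unshift_neg N m \oc (fmap v (eqm e) \oc eps (aut_inv S Y))
  end.

Definition unshift (N : C) (i : int) : hom (v (aut_pow S i N)) (v N) :=
  match i with
  | Posz n => unshift_pos N n
  | Negz n => unshift_neg N n.+1
  end.

Definition graded_hom (M N : C) : Type :=
  { f : forall i : int, hom M (aut_pow S i N)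
  | finite_set [set i | f i != 0]%classic }.

Definition total_hom (M N : C) (f : graded_hom M N) : hom (v M) (v N) :=
  \sum_(i \in [set: int]%classic) (unshift N i \oc fmap v (sval f i)).

Record graded_cover : Prop := GradedCover {
  gc_abelian : abelian C;
  gc_exact : exact_functor v;
  gc_hom : forall M N : C, bijective (@total_hom M N);
  gc_epi : forall (M : B) (N : C) (f : hom M (v N)), epic f ->
    exists (P : C) (p : hom (v P) M) (q : hom P N),
      epic p /\ fmap v q = f \oc p }.

End GradedCover.

Section CoverEquivalence.
Variables (B : preadditive) (X Y : cover_data B).

Record cover_equivalence := CoverEquivalence {
  ce_fun : functor (cv_cat X) (cv_cat Y);
  ce_additive : additive_functor ce_fun;
  ce_eps : nat_iso (cv_shift Y \of ce_fun) (ce_fun \of cv_shift X);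
  ce_pi : nat_iso (cv_fun Y \of ce_fun) (cv_fun X);
  ce_compat : forall M : cv_cat X,
    ce_pi (cv_shift X M) \oc fmap (cv_fun Y) (ce_eps M)
      \oc cv_eps Y (ce_fun M)
    = cv_eps X M \oc ce_pi M }.

End CoverEquivalence.

Definition cover_equivalent (B : preadditive) (X Y : cover_data B) : Prop :=
  inhabited (cover_equivalence X Y) \/ inhabited (cover_equivalence Y X).

(* Left ideals of A are the submodules of the regular left module A^o. *)
Definition left_artinian (A : pzRingType) : Prop :=
  forall I : nat -> {pred A^o},
    (forall n, GRing.submod_closed (I n)) ->
    (forall n, {subset I n.+1 <= I n}) ->
    exists n, forall m, (n <= m)%N -> I m =i I n.

Definition finitely_generated (A : pzRingType) (M : lmodType A) : Prop :=
  exists (n : nat) (g : 'I_n -> M),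
    forall x, exists c : 'I_n -> A, x = \sum_(i < n) c i *: g i.

Section LinMap.
Variables (A : pzRingType) (U V : lmodType A).
Implicit Types f g h : {linear U -> V}.

Lemma linmap_eq f g : f =1 g -> f = g.
Proof.
case: f => f [[f1] [f2]]; case: g => g [[g1] [g2]] /= /funext fg.
case: _ / fg in g1 g2 *.
by rewrite (Prop_irrelevance f1 g1) (Prop_irrelevance f2 g2).
Qed.

HB.instance Definition _ := gen_eqMixin {linear U -> V}.
HB.instance Definition _ := gen_choiceMixin {linear U -> V}.

Definition linmap0 : {linear U -> V} := \0.
Definition linmapN f : {linear U -> V} := \- f.
Definition linmapD f g : {linear U -> V} := f \+ g.

Fact linmapDA : associative linmapD.
Proof. by move=> f g h; apply: linmap_eq => x /=; rewrite addrA. Qed.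
Fact linmapDC : commutative linmapD.
Proof. by move=> f g; apply: linmap_eq => x /=; rewrite addrC. Qed.
Fact linmap0D : left_id linmap0 linmapD.
Proof. by move=> f; apply: linmap_eq => x /=; rewrite add0r. Qed.
Fact linmapND : left_inverse linmap0 linmapN linmapD.
Proof. by move=> f; apply: linmap_eq => x /=; rewrite addNr. Qed.

HB.instance Definition _ :=
  GRing.isZmodule.Build {linear U -> V} linmapDA linmapDC linmap0D linmapND.

End LinMap.

Definition linmap_id (A : pzRingType) (U : lmodType A) : {linear U -> U} :=
  idfun.
Definition linmap_comp (A : pzRingType) (U V W : lmodType A)
    (g : {linear V -> W}) (f : {linear U -> V}) : {linear U -> W} := g \o f.

Record fgmod (A : pzRingType) := FgMod {
  fgmod_sort :> lmodType A;
  fgmod_fg : finitely_generated fgmod_sort }.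

Definition modf (A : pzRingType) : preadditive.
Proof.
refine (@Preadditive (fgmod A) (fun M N => {linear M -> N} : zmodType)
  (fun M => linmap_id M) (fun M N P g f => linmap_comp g f) _ _ _ _ _).
- by move=> *; apply: linmap_eq.
- by move=> *; apply: linmap_eq.
- by move=> *; apply: linmap_eq.
- by move=> *; apply: linmap_eq.
- by move=> M N P g f f'; apply: linmap_eq => x /=; rewrite linearD.
Defined.

(* V is the internal direct sum of the subgroups G i. *)
Definition is_direct_sum (V : zmodType) (G : int -> {pred V}) : Prop :=
  (forall i, GRing.zmod_closed (G i)) /\
  forall x, exists! c : int -> V,
    [/\ forall i, c i \in G i, finite_set [set i | c i != 0]%classic
      & x = \sum_(i \in [set: int]%classic) c i].

Record grading (A : pzRingType) := Grading {
  gr_comp :> int -> {pred A};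
  gr_direct : is_direct_sum gr_comp;
  gr_one : 1 \in gr_comp 0;
  gr_mul : forall i j a b,
    a \in gr_comp i -> b \in gr_comp j -> a * b \in gr_comp (i + j) }.

Section GradedModules.
Variables (A : pzRingType) (G : grading A).

Definition is_module_grading (M : lmodType A) (D : int -> {pred M}) : Prop :=
  is_direct_sum D /\
  forall i j (a : A) (x : M), a \in G i -> x \in D j -> a *: x \in D (i + j).

Record grmod := GrMod {
  grmod_sort :> fgmod A;
  grmod_comp : int -> {pred grmod_sort};
  grmod_grading : is_module_grading grmod_comp }.

Arguments grmod_comp M j : clear implicits, rename.

Definition homogeneous (M N : grmod) : {pred {linear M -> N}} :=
  fun f => `[< forall j x, x \in grmod_comp M j -> f x \in grmod_comp N j >].

Fact homogeneous_zmod (M N : grmod) : GRing.zmod_closed (@homogeneous M N).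
Proof.
have clN j : GRing.zmod_closed (grmod_comp N j).
  by case: (grmod_grading N) => -[].
split=> [|f g /asboolP fP /asboolP gP]; apply/asboolP => j x xj.
  by have [] := clN j.
by have [_] := clN j; apply; [exact: fP | exact: gP].
Qed.

HB.instance Definition _ (M N : grmod) :=
  GRing.isZmodClosed.Build {linear M -> N} (@homogeneous M N)
    (@homogeneous_zmod M N).

Record grhom (M N : grmod) := GrHom {
  grhom_val :> {linear M -> N};
  grhom_homogeneous : grhom_val \in @homogeneous M N }.

HB.instance Definition _ (M N : grmod) := [isSub for @grhom_val M N].
HB.instance Definition _ (M N : grmod) := [Choice of grhom M N by <:].
HB.instance Definition _ (M N : grmod) :=
  [SubChoice_isSubZmodule of grhom M N by <:].

Lemma grhomP (M N : grmod) (f : grhom M N) j x :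
  x \in grmod_comp M j -> f x \in grmod_comp N j.
Proof. by case: f => f /= /asboolP; exact. Qed.

Fact grhom_id_subproof (M : grmod) : linmap_id M \in @homogeneous M M.
Proof. exact/asboolP. Qed.
Definition grhom_id (M : grmod) : grhom M M := GrHom (grhom_id_subproof M).

Fact grhom_comp_subproof (M N P : grmod) (g : grhom N P) (f : grhom M N) :
  linmap_comp g f \in @homogeneous M P.
Proof. by apply/asboolP => j x xj /=; do 2 apply: grhomP. Qed.
Definition grhom_comp (M N P : grmod) (g : grhom N P) (f : grhom M N) :
  grhom M P := GrHom (grhom_comp_subproof g f).

Definition grmodf : preadditive.
Proof.
refine (@Preadditive grmod (fun M N => grhom M N : zmodType)
  (fun M => grhom_id M) (fun M N P g f => grhom_comp g f) _ _ _ _ _).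
- by move=> *; apply/val_inj/linmap_eq.
- by move=> *; apply/val_inj/linmap_eq.
- by move=> *; apply/val_inj/linmap_eq.
- by move=> *; apply/val_inj/linmap_eq.
- by move=> M N P g f f'; apply/val_inj/linmap_eq => x /=; rewrite linearD.
Defined.

Definition forget : functor grmodf (modf A) :=
  @Functor grmodf (modf A) grmod_sort (fun M N f => grhom_val f)
    (fun _ => erefl) (fun _ _ _ _ _ => erefl).

Fact shift_direct (V : zmodType) (D : int -> {pred V}) (k : int) :
  is_direct_sum D -> is_direct_sum (fun j => D (k + j)).
Proof.
move=> [clD exD]; split=> // x; have [c [[cD cfin cx] cU]] := exD x.
have shK l (d : int -> V) : finite_set [set i | d i != 0]%classic ->
    finite_set [set i | d (l + i) != 0]%classic.
  move=> dfin; have -> : [set i | d (l + i) != 0]%classic =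
      [set - l + i | i in [set i | d i != 0]]%classic.
    apply/seteqP; split=> [i /= di|_ [i /= di <-]]; last by rewrite addNKr.
    by exists (l + i); rewrite ?addKr.
  exact: finite_image.
have shS l (d : int -> V) : \sum_(i \in [set: int]%classic) d i =
    \sum_(i \in [set: int]%classic) d (l + i).
  apply: (reindex_fsbigT (fun i => l + i)).
  by exists (fun i => - l + i) => i; rewrite ?addKr ?addNKr.
exists (fun j => c (k + j)); split.
  by split=> //; [exact: shK | rewrite cx; exact: shS].
move=> d [dD dfin dx]; apply/funext => j.
have -> : c = fun i => d (- k + i).
  apply: cU; split; [|exact: shK|by rewrite dx; exact: shS].
  by move=> i; have := dD (- k + i); rewrite addNKr.
by rewrite addKr.
Qed.

Fact shift_grading (M : grmod) (k : int) :
  is_module_grading (fun j => grmod_comp M (k + j)).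
Proof.
have [Mdir Mact] := grmod_grading M.
split=> [|i j a x ai xj]; first exact: shift_direct.
by rewrite addrCA; exact: Mact.
Qed.

Definition shift_obj (k : int) (M : grmod) : grmod :=
  GrMod (shift_grading M k).

Fact shift_hom_subproof k (M N : grmod) (f : grhom M N) :
  (f : {linear shift_obj k M -> shift_obj k N})
    \in @homogeneous (shift_obj k M) (shift_obj k N).
Proof. by apply/asboolP => j x; exact: (@grhomP _ _ f). Qed.

Definition shift_hom k (M N : grmod) (f : grhom M N) :
  grhom (shift_obj k M) (shift_obj k N) := GrHom (shift_hom_subproof k f).

Definition grshift (k : int) : functor grmodf grmodf.
Proof.
refine (@Functor grmodf grmodf (shift_obj k) (shift_hom k) _ _).
- by move=> M; exact/val_inj.
- by move=> M N P g f; exact/val_inj.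
Defined.

Lemma grshiftK (k l : int) : l + k = 0 ->
  grshift k \of grshift l = id_functor grmodf.
Proof.
move=> lk0; have eE (V : fgmod A) (D1 D2 : int -> {pred V}) :
    D1 = D2 -> forall (g1 : is_module_grading D1) (g2 : is_module_grading D2)
    (e : GrMod g1 = GrMod g2 :> grmodf) (x : V),
    (eqm e : grhom (GrMod g1) (GrMod g2)) x = x.
  move=> DD; case: _ / DD => g1 g2; rewrite (Prop_irrelevance g2 g1) => e x.
  by rewrite (Prop_irrelevance e erefl).
have obD (V : fgmod A) (D1 D2 : int -> {pred V}) : D1 = D2 ->
    forall (g1 : is_module_grading D1) (g2 : is_module_grading D2),
    GrMod g1 = GrMod g2.
  by move=> DD; case: _ / DD => g1 g2; rewrite (Prop_irrelevance g2 g1).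
have compE M j : grmod_comp M (l + (k + j)) = grmod_comp M j.
  by rewrite addrA lk0 add0r.
have obE (M : grmodf) : (grshift k \of grshift l) M = id_functor grmodf M.
  case: M => V D gD; apply: obD.
  by apply/funext => j; exact: (compE (GrMod gD)).
apply: (functor_eq (e := obE)) => M N f; apply/val_inj/linmap_eq => x /=.
have DE (P : grmod) : (fun j => grmod_comp P (l + (k + j))) = grmod_comp P.
  by apply/funext => j; exact: compE.
case: M N f x => [V D gD] [W E gE] f x.
etransitivity; first exact: eE (DE (GrMod gE)) _ _ _ _.
by congr (grhom_val f _); symmetry; apply: eE (DE (GrMod gD)) _ _ _ _.
Qed.

Definition grshift1 : automorphism grmodf :=
  Automorphism (grshiftK (addrN 1)) (grshiftK (addNr 1)).

(* The underlying modules of M[1] and M are convertible; epsilon is the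
   identity. *)
Definition forget_eps : nat_iso forget (forget \of grshift1).
Proof.
refine (@NatIso grmodf (modf A) forget (forget \of grshift1)
  (fun M => linmap_id M) (fun M => linmap_id M) _ _ _);
  by move=> *; exact: linmap_eq.
Defined.

Definition grmodf_cover : cover_data (modf A) := CoverData forget_eps.

End GradedModules.

Arguments grmod_comp {A G} M j : rename.

(* Main.v *)
Require Import Defs.
From HB Require Import structures.
From mathcomp Require Import all_boot all_order all_algebra.
From mathcomp Require Import all_classical.
From mathcomp Require Import generic_quotient ring_quotient.
Set Implicit Arguments.
Unset Strict Implicit.
Unset Printing Implicit Defensive.
Import GRing.Theory.
Import Defs.
Local Open Scope ring_scope.
Local Open Scope classical_set_scope.

(** The statement reduces to lifting the regular module: finding an object [Q] of
the cover with [vQ] isomorphic to [A]. Given [Q], the homogeneous maps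
[vQ -> vQ] of each degree decompose [End(vQ)], hence [A], into a grading. In the
same way the homogeneous maps [vQ -> vM] grade [vM = Hom(A, vM) = Hom(vQ, vM)].
Thus [M] is sent to the module [vM] with this grading, the comparison with [v] is
the identity, and [epsilon], which is homogeneous of degree [-1], gives the
compatibility with shifts ([regrade_equivalence]).

The identity of [A] is a sum of orthogonal idempotents [g] that are minimal, in
the sense that [A g] contains no smaller nonzero left ideal generated by an
idempotent, and biproducts reduce the problem to lifting each [A g]
([lift_idem], [lift_min_idem]). What matters about [A g] is that it is projective
and hollow: it is not the sum of two proper left subideals ([min_idem_hollow]).

The covering axiom gives [P] with a surjection [vP -> A], hence one onto [A g].
Since [vP] is artinian there is an injective homogeneous map from some [vQ] to
[vP] whose image is minimal among those that still map onto [A g]. Let [r] be the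
resulting surjection [vQ -> A g], [s] a section, [del = 1 - s r], and [del_i] the
homogeneous components of [del]; it must be shown that [del = 0].

- If [i] is not 0, then [del_i] is nilpotent: [1 - del_i] is injective, hence
  invertible, and its inverse can only be the geometric series of [del_i], which
  therefore has finitely many terms ([of_degree_nilpotent]). So [del_i] is not
  surjective, and by minimality [r del_i] is not onto [A g].
- As [r del = 0] and [A g] is hollow, [r del_0] is not onto [A g] either.
- Consequently [r w] is not onto [A g] for any product [w] of components. For
  large [n], [vQ = im w^n + ker w^n] by the descending chain condition; hollowness
  makes the kernel map onto [A g], and minimality gives [w^n = 0].
- An idempotent endomorphism of a finitely generated artinian module is zero if it
  is a finite sum of maps all of whose products are nilpotent
  ([nil_words_idem]). *)

(** * Submodules and the descending chain condition *)

Section Submodules.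
Variables (A : pzRingType).
Implicit Types M : lmodType A.

Definition submodule M (N : set M) : Prop :=
  N 0 /\ forall (a : A) x y, N x -> N y -> N (a *: x + y).

Lemma submodD M (N : set M) x y : submodule N -> N x -> N y -> N (x + y).
Proof. by move=> [_ N2] Nx Ny; rewrite -[x]scale1r; exact: N2. Qed.

Lemma submodZ M (N : set M) a x : submodule N -> N x -> N (a *: x).
Proof. by move=> [N0 N2] Nx; rewrite -[_ *: _]addr0; exact: N2. Qed.

Lemma submodB M (N : set M) x y : submodule N -> N x -> N y -> N (x - y).
Proof. by move=> sN Nx Ny; rewrite addrC -scaleN1r; case: sN => _; exact. Qed.

Lemma submod_sum M (N : set M) (I : eqType) (s : seq I) (F : I -> M) :
  submodule N -> (forall i, i \in s -> N (F i)) -> N (\sum_(i <- s) F i).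
Proof.
move=> sN NF; elim: s NF => [|i s IH] NF; first by rewrite big_nil; case: sN.
rewrite big_cons; apply: submodD => //; first by apply: NF; rewrite mem_head.
by apply: IH => j js; apply: NF; rewrite inE js orbT.
Qed.

Fixpoint lspan M (s : seq M) : set M :=
  if s is g :: s' then [set x | exists a y, lspan s' y /\ x = a *: g + y]
  else [set 0].

Lemma lspan_submod M (s : seq M) : submodule (lspan s).
Proof.
elim: s => [|g s [IH0 IH2]] /=.
  by split=> // a x y -> ->; rewrite scaler0 addr0.
split; first by exists 0, 0; rewrite scale0r addr0.
move=> a x y [b [x' [sx ->]]] [c [y' [sy ->]]].
exists (a * b + c), (a *: x' + y'); split; first exact: IH2.
by rewrite scalerDr scalerA scalerDl addrACA.
Qed.

Lemma mem_lspan M (s : seq M) x : x \in s -> lspan s x.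
Proof.
elim: s => // g s IH; rewrite inE => /orP[/eqP ->|xs] /=.
  exists 1, 0; rewrite scale1r addr0; split=> //.
  by have [] := lspan_submod s.
by exists 0, x; rewrite scale0r add0r; split=> //; exact: IH.
Qed.

Lemma lspan_sub M (s : seq M) (N : set M) :
  submodule N -> (forall x, x \in s -> N x) -> lspan s `<=` N.
Proof.
move=> sN; elim: s => [|g s IH] Ns x /=; first by move=> ->; case: sN.
move=> [a [y [sy ->]]]; have [_] := sN; apply.
  by apply: Ns; rewrite mem_head.
by apply: IH sy => z zs; apply: Ns; rewrite inE zs orbT.
Qed.

Lemma fg_lspan M : finitely_generated M -> exists s : seq M, lspan s = [set: M].
Proof.
move=> [n [g gM]]; exists (codom g); apply/seteqP; split=> // x _.
have [c ->] := gM x; apply: submod_sum; first exact: lspan_submod.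
move=> i _; apply: submodZ; first exact: lspan_submod.
by apply: mem_lspan; apply: codom_f.
Qed.

Definition min_condition M := forall F : set (set M),
  F `<=` @submodule M -> F !=set0 ->
  exists2 N, F N & forall N', F N' -> N' `<=` N -> N' = N.

(** A family without minimal element would give, by dependent choice, a strictly
decreasing sequence. *)
Lemma chain_min M :
  (forall N : nat -> set M, (forall n, submodule (N n)) ->
    (forall n, N n.+1 `<=` N n) -> exists n, N n.+1 = N n) ->
  min_condition M.
Proof.
move=> chain F Fsub [N0 FN0]; apply: contrapT => noMin.
have next (N : {N | F N}) : exists N' : {N | F N},
    sval N' `<=` sval N /\ sval N' <> sval N.
  case: N => N FN /=; apply: contrapT => no; apply: noMin; exists N => //.
  move=> N' FN' N'N; apply: contrapT => ne; apply: no.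
  by exists (exist _ N' FN').
have [f fP] := choice next.
pose S n := iter n f (exist _ N0 FN0).
have [n] : exists n, sval (S n.+1) = sval (S n).
  apply: chain => n; first by apply: Fsub; exact: svalP.
  by have [] := fP (S n).
by have [] := fP (S n).
Qed.

(** Induction on the generators. For a chain [N] the coefficients with which [g]
occurs in [N n], modulo the span of the remaining generators, form a decreasing
chain of left ideals; once it and the chain cut out in that span are both
stationary, so is [N] on the whole span. *)
Lemma artinian_chain M (hA : left_artinian A) (s : seq M)
    (N : nat -> set M) : (forall n, submodule (N n)) ->
  (forall m n, (m <= n)%N -> N n `<=` N m) ->
  exists n, forall m x, (n <= m)%N -> lspan s x -> N n x -> N m x.
Proof.
move=> sN dN; elim: s => [|g s [n1 IH]] /=.
  by exists 0%N => m x _ -> _; have [] := sN m.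
pose I n : {pred A^o} :=
  fun a : A => `[< exists2 y, lspan s y & N n (a *: g + y) >].
have [| |n2 In2] := hA I.
- move=> n; split; first apply/asboolP.
    exists 0; first by have [] := lspan_submod s.
    by rewrite scale0r addr0; have [] := sN n.
  move=> a u v /asboolP[x sx Nx] /asboolP[y sy Ny]; apply/asboolP.
  exists (a *: x + y); first by have [_] := lspan_submod s; apply.
  rewrite scalerDl -scalerA addrACA -scalerDr.
  by have [_] := sN n; apply.
- move=> n u /asboolP[y sy Ny]; apply/asboolP; exists y => //.
  by apply: dN Ny.
exists (maxn n1 n2) => m _ nm [a [y [sy ->]]] Na.
have nm1 : (n1 <= m)%N by apply: leq_trans nm; rewrite leq_maxl.
have nm2 : (n2 <= m)%N by apply: leq_trans nm; rewrite leq_maxr.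
have : a \in I m.
  rewrite In2 //; apply/asboolP; exists y => //.
  by apply: dN Na; rewrite leq_maxr.
move=> /asboolP[y' sy' Ny'].
have Nyy : N m (y - y').
  apply: IH => //; first by apply: submodB => //; exact: lspan_submod.
  have -> : y - y' = (a *: g + y) - (a *: g + y') by rewrite opprD addrACA subrr add0r.
  apply: submodB => //; first by apply: dN Na; rewrite leq_maxl.
  by apply: dN Ny'.
have -> : a *: g + y = (a *: g + y') + (y - y') by rewrite -addrA [y' + _]addrC addrNK.
by apply: submodD.
Qed.

Lemma artinian_min M :
  left_artinian A -> finitely_generated M -> min_condition M.
Proof.
move=> hA /fg_lspan[s sM]; apply: chain_min => N sN dN.
have dN' m n : (m <= n)%N -> N n `<=` N m.
  elim: n => [|n IH]; first by rewrite leqn0 => /eqP ->.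
  rewrite leq_eqVlt => /orP[/eqP -> //|/IH mn].
  by apply: subset_trans mn.
have [n nP] := artinian_chain hA s sN dN'.
exists n; apply/seteqP; split=> // x Nx; apply: nP => //.
by rewrite sM.
Qed.

End Submodules.

Section Endomorphisms.
Variables (A : pzRingType) (M : lmodType A).
Implicit Types (f g w : {linear M -> M}) (U D : set M).

Lemma image_submod (M' : lmodType A) (f : {linear M -> M'}) U :
  submodule U -> submodule (f @` U).
Proof.
move=> [U0 U2]; split; first by exists 0; rewrite ?linear0.
move=> a _ _ [x Ux <-] [y Uy <-]; exists (a *: x + y); rewrite ?linearP //.
exact: U2.
Qed.

Lemma preimage_submod (M' : lmodType A) (f : {linear M -> M'}) (U : set M') :
  submodule U -> submodule (f @^-1` U).
Proof.
move=> [U0 U2]; split; first by rewrite /= linear0.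
by move=> a x y /= fx fy; rewrite linearP; exact: U2.
Qed.

Lemma sum_submod U D :
  submodule U -> submodule D ->
  submodule [set z | exists x y, [/\ U x, D y & z = x + y]].
Proof.
move=> sU sD; split.
  by exists 0, 0; rewrite addr0; split=> //; [case: sU|case: sD].
move=> a _ _ [x [y [Ux Dy ->]]] [x' [y' [Ux' Dy' ->]]].
exists (a *: x + x'), (a *: y + y'); split.
- by case: sU => _; apply.
- by case: sD => _; apply.
- by rewrite scalerDr addrACA.
Qed.

Lemma setT_submod : submodule [set: M]. Proof. by []. Qed.

Lemma iterD_lin n f x y : iter n f (x + y) = iter n f x + iter n f y.
Proof. by elim: n => //= n ->; rewrite linearD. Qed.

Lemma iterB_lin n f x y : iter n f (x - y) = iter n f x - iter n f y.
Proof. by elim: n => //= n ->; rewrite linearB. Qed.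

Lemma iter_submod n f U : submodule U -> submodule (iter n f @` U).
Proof.
move=> sU; elim: n => [|n IH] /=; first by rewrite image_id.
have -> : iter n.+1 f @` U = f @` (iter n f @` U) by rewrite image_comp.
exact: image_submod.
Qed.

(** The decreasing images of the iterates of [f] become stationary; this is the
half [M = im f^n + ker f^n] of Fitting's lemma. *)
Lemma iter_stab f : min_condition M -> exists2 n, (0 < n)%N &
  forall x, exists y, iter n f x = iter n f (iter n f y).
Proof.
move=> minM.
have [||_ [n n0 <-] nmin] :=
    minM [set iter n f @` [set: M] | n in [set n | (0 < n)%N]].
- by move=> _ [n _ <-]; apply: iter_submod; exact: setT_submod.
- by exists (iter 1 f @` [set: M]), 1%N.
exists n => // x.
have /= E := nmin (iter (n + n) f @` [set: M]).
have : (iter (n + n) f @` [set: M]) (iter n f x).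
  rewrite E; first by exists x.
    by exists (n + n)%N => //=; rewrite addn_gt0 n0.
  by move=> _ [y _ <-]; rewrite iterD; exists (iter n f y).
by move=> [y _ <-]; exists y; rewrite -iterD.
Qed.

(** By [iter_stab] and injectivity, [x] lies in the image of an iterate of [f]. *)
Lemma inj_surj f : min_condition M -> injective f ->
  forall x, exists y, f y = x.
Proof.
move=> minM injf x; have [n n0 nP] := iter_stab f minM.
have I : injective (iter n f) by elim: n {nP n0} => //= n IH u v /injf /IH.
have [y /I ->] := nP x; exists (iter n.-1 f y).
by rewrite -iterS prednK.
Qed.

End Endomorphisms.

(** * Idempotent sums of nilpotent words *)

Section NilpotentWords.
Variables (A : pzRingType) (M : lmodType A) (T : eqType) (J : seq T).
Variable (l : T -> {linear M -> M}).

(** The nonempty products of letters, that is, the multiplicative semigroup that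
the letters generate. *)
Inductive word : {linear M -> M} -> Prop :=
| Letter i of i \in J : word (l i)
| Concat u v of word u & word v : word (linmap_comp u v).

Definition stable (U : set M) := forall i x, i \in J -> U x -> U (l i x).

Lemma word_stable U w x : stable U -> word w -> U x -> U (w x).
Proof.
move=> sU ww; elim: ww x => {w} [i iJ|u v _ IHu _ IHv] x Ux; first exact: sU.
by apply/IHu/IHv.
Qed.

(** When [s] generates a submodule [D], these elements generate the sum of the
images [l i D]. *)
Definition letters_of (s : seq M) : seq M := [seq l i x | i <- J, x <- s].

Lemma mem_letters_of s i x : i \in J -> lspan s x -> lspan (letters_of s) (l i x).
Proof.
move=> iJ; apply: (lspan_sub (N := l i @^-1` lspan (letters_of s))).
  exact/preimage_submod/lspan_submod.
by move=> y ys; apply/mem_lspan/allpairs_f.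
Qed.

Lemma letters_of_sub s (U : set M) : submodule U ->
  (forall i x, i \in J -> lspan s x -> U (l i x)) -> lspan (letters_of s) `<=` U.
Proof.
move=> sU lU; apply: lspan_sub => // _ /allpairsP[[i x] /= [iJ xs ->]].
by apply: lU => //; apply: mem_lspan.
Qed.

Definition proper_stable (D U : set M) :=
  [/\ submodule U, stable U, U `<=` D & ~ D `<=` U].

(** Zorn's lemma: since [lspan s] is finitely generated, the union of a chain of
proper stable submodules is proper. *)
Lemma max_stable (s : seq M) : ~ lspan s `<=` [set 0] ->
  exists2 U, proper_stable (lspan s) U &
    forall U', submodule U' -> stable U' -> U `<=` U' -> U' `<=` lspan s ->
      ~ U' `<=` U -> lspan s `<=` U'.
Proof.
move=> Dn0; pose D := lspan s.
have proper0 : proper_stable D [set 0].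
  split=> //; first by split=> // a x y -> ->; rewrite scaler0 addr0.
    by move=> i x _ ->; rewrite linear0.
  by move=> _ ->; have [] := lspan_submod s.
(* The empty set is added because the union of the empty chain must qualify. *)
have [F FP Ftot|U [PU Umax]] :=
    @Zorn_bigcup M [set U | U = set0 \/ proper_stable D U].
  have [[X [FX Xn0]]|no] := pselect (exists X, F X /\ X <> set0); last first.
    left; apply/seteqP; split=> // x [X FX Xx]; apply: no; exists X; split=> //.
    by move=> X0; rewrite X0 in Xx.
  have gF Y y : F Y -> Y y -> proper_stable D Y.
    by move=> FY Yy; have [Y0|//] := FP _ FY; rewrite Y0 in Yy.
  have [x0 Xx0] : X !=set0 by apply/set0P/eqP.
  have gX := gF _ _ FX Xx0.
  right; split.
  - split; first by exists X => //; case: gX => -[].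
    move=> a x y [Y FY Yx] [Z FZ Zy].
    have [[_ Y2] _ _ _] := gF _ _ FY Yx; have [[_ Z2] _ _ _] := gF _ _ FZ Zy.
    have [YZ|ZY] := Ftot _ _ FY FZ.
      by exists Z => //; apply: Z2 => //; exact: YZ.
    by exists Y => //; apply: Y2 => //; exact: ZY.
  - move=> i x iJ [Y FY Yx]; have [_ stY _ _] := gF _ _ FY Yx.
    by exists Y => //; exact: stY.
  - by move=> x [Y FY Yx]; have [_ _ YD _] := gF _ _ FY Yx; exact: YD.
  move=> DF.
  have [Y FY Ys] : exists2 Y, F Y & proper_stable D Y /\ forall x, x \in s -> Y x.
    have {DF} sF x : x \in s -> (\bigcup_(X in F) X) x.
      by move=> xs; apply/DF/mem_lspan.
    elim: (s) sF => [|g s' IH] sF; first by exists X.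
    have [|Y FY [gY Ys]] := IH; first by move=> x xs; apply: sF; rewrite inE xs orbT.
    have [Z FZ Zg] := sF g (mem_head _ _).
    have [YZ|ZY] := Ftot _ _ FY FZ.
      exists Z => //; split=> [|x]; first exact: gF Zg.
      by rewrite inE => /orP[/eqP ->//|/Ys /YZ].
    exists Y => //; split=> // x.
    by rewrite inE => /orP[/eqP ->|/Ys //]; exact: ZY.
  case: Ys => -[sY _ _ nDY] Ys; apply: nDY.
  exact: lspan_sub.
have {PU} gU : proper_stable D U.
  case: PU => // U0; have /Umax[] : U `<` [set 0].
    by split; rewrite U0 // => /(_ 0 erefl).
  by right.
exists U => // U' sU' stU' UU' U'D nU'U; apply: contrapT => nDU'.
by apply: (Umax U'); [split|right].
Qed.

Hypothesis minM : min_condition M.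
Hypothesis nil_word : forall w, word w -> exists n, forall x, iter n w x = 0.

(** A form of Levitzki's theorem. Suppose [D = lspan s] is nonzero and equal to
the sum of its images under the letters, and let [U] be maximal among its proper
stable submodules. Some word does not map [D] into [U]; take [w] such that
[w D + U] is minimal. The images of [D] under [w w], and under [w t w] for every
word [t], lie in [U]: otherwise minimality gives [w D] inside [w t (w D) + U], and
iterating the nilpotent [w t] puts [w D] in [U]. Hence the elements of [D]
that [w], and [w] times any word, map into [U] form a stable submodule containing
[U] and [w D]. By maximality it is all of [D], contradicting the choice of [w]. *)
Lemma nil_words_lspan (s : seq M) : stable (lspan s) ->
  lspan s `<=` lspan (letters_of s) -> lspan s `<=` [set 0].
Proof.
move=> stD DlD; apply: contrapT => /max_stable[U [sU stU UD nDU] Umax].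
pose D := lspan s.
have sD : submodule D := lspan_submod s.
pose plus (w : {linear M -> M}) :=
  [set z | exists x y, [/\ (w @` D) x, U y & z = x + y]].
have [||_ [w [ww nwU] <-] wmin] :=
    minM (F := [set plus w | w in [set w | word w /\ ~ w @` D `<=` U]]).
- by move=> _ [w _ <-]; apply: sum_submod => //; exact: image_submod.
- suff [w ww] : exists w, word w /\ ~ w @` D `<=` U by exists (plus w), w.
  apply: contrapT => no; apply: nDU => x /DlD; apply: letters_of_sub => //.
  move=> i y iJ sy; apply: contrapT => nU; apply: no; exists (l i).
  by split; [exact: Letter|move=> /(_ (l i y)); apply: contra_not nU; apply; exists y].
(* The nilpotent n is to be w itself or the product of w with a word t. *)
have key n : word n -> (forall x, D x -> exists2 y, D y & n (w x) = w y) ->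
    forall x, D x -> U (n (w x)).
  move=> wn nw x Dx; apply: contrapT => nU.
  have wE : plus (linmap_comp n w) = plus w.
    apply: wmin.
      exists (linmap_comp n w) => //; split; first exact: Concat.
      by move=> nwU'; apply: nU; apply: nwU'; exists x.
    move=> _ [_ [u [[y Dy <-] Uu ->]]] /=; have [z Dz ->] := nw y Dy.
    by exists (w z), u; split=> //; exists z.
  apply: nwU => _ [y Dy <-].
  have [k nk0] := nil_word wn.
  suff [z [u [Dz Uu ->]]] : exists z u, [/\ D z, U u & w y = iter k n (w z) + u].
    by rewrite nk0 add0r.
  elim: k {nk0} => [|k [z [u [Dz Uu ->]]]].
    by exists y, 0; rewrite addr0; split=> //; case: sU.
  have : plus w (w z).
    by exists (w z), 0; split; [exists z|case: sU|rewrite addr0].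
  rewrite -wE => -[_ [u' [[z' Dz' <-] Uu' ->]]] /=.
  exists z', (iter k n u' + u); rewrite iterD_lin -iterSr -addrA; split=> //.
  apply: submodD => //; elim: k => //= k IH.
  exact: word_stable IH.
pose U' := [set x | [/\ D x, U (w x) & forall t, word t -> U (w (t x))]].
have wD x : D x -> D (w x) by apply: word_stable.
have DU' : D `<=` U'.
  apply: Umax.
  - split; first by rewrite /U' /= linear0; split=> [||t _];
      rewrite ?linear0; by [case: sD|case: sU].
    move=> a x y [Dx Ux Utx] [Dy Uy Uty]; split.
    + by case: sD => _; apply.
    + by rewrite linearP; case: sU => _; apply.
    + by move=> t wt; rewrite !linearP; case: sU => _; apply; [exact: Utx|exact: Uty].
  - move=> i x iJ [Dx Ux Utx]; split; first exact: stD.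
      by apply: Utx; exact: Letter.
    move=> t wt; apply: (Utx (linmap_comp t (l i))).
    by apply: Concat => //; exact: Letter.
  - move=> x Ux; have stw t : word t -> U (t x) by move=> wt; exact: word_stable Ux.
    split; [exact: UD|exact: stw|move=> t wt].
    by apply: (word_stable stU ww); exact: stw.
  - by move=> x [].
  move=> U'U; apply: nwU => _ [x Dx <-]; apply: U'U; split; first exact: wD.
    by apply: key => // y Dy; exists (w y) => //; exact: wD.
  move=> t wt; apply: (key (linmap_comp w t)) => //; first exact: Concat.
  by move=> y Dy; exists (t (w y)) => //; apply: word_stable wt _ => //; exact: wD.
by apply: nwU => _ [x Dx <-]; have [] := DU' _ Dx.
Qed.

(** Apply [nil_words_lspan] to a minimal finitely generated stable submodule that
contains the image of [d]: the sum of its images under the letters is another one,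
because [d] is idempotent. *)
Lemma nil_words_idem (d : {linear M -> M}) :
  finitely_generated M ->
  (forall x, d x = \sum_(i <- J) l i x) -> (forall x, d (d x) = d x) ->
  forall x, d x = 0.
Proof.
move=> /fg_lspan[s0 s0M] dE dd.
pose F := [set N | exists s, [/\ N = lspan s, stable N & forall x, N (d x)]].
have [||N [s [NE stN dN]] Nmin] := minM (F := F).
- by move=> _ [s [-> _ _]]; exact: lspan_submod.
- by exists [set: M]; exists s0; split=> //; rewrite s0M.
have sN : submodule N by rewrite NE; exact: lspan_submod.
have lN i y : i \in J -> N y -> lspan (letters_of s) (l i y).
  by rewrite NE => iJ; apply: mem_letters_of.
have NlN : lspan (letters_of s) = N.
  apply: Nmin.
    exists (letters_of s); split=> // [i x iJ sx|x].
      apply: lN => //; apply: letters_of_sub sx => // j y jJ sy.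
      by apply: stN => //; rewrite NE.
    rewrite -dd dE; apply: submod_sum; first exact: lspan_submod.
    by move=> i iJ; apply: lN.
  apply: letters_of_sub => // i x iJ sx.
  by apply: stN => //; rewrite NE.
move=> x; apply: (@nil_words_lspan s); rewrite -?NE // NlN //.
Qed.

End NilpotentWords.

(** * Minimal idempotents of a left artinian ring *)

Section Idempotents.
Variable A : pzRingType.
Implicit Types (a b c e g u x : A) (I : set A^o).

Lemma regular_fg : finitely_generated A^o.
Proof.
exists 1%N, (fun=> 1) => x; exists (fun=> x).
by rewrite big_ord1 /= /GRing.scale /= mulr1.
Qed.

Lemma ideal_mul I a x : submodule I -> I x -> I (a * x).
Proof. by move=> sI Ix; exact: (submodZ a sI Ix). Qed.

Definition rmul_fun x (a : A^o) : A^o := (a : A) * x.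
Fact rmul_linear x : linear (rmul_fun x).
Proof. by move=> a b c; rewrite /rmul_fun mulrDl -mulrA. Qed.
HB.instance Definition _ x :=
  GRing.isLinear.Build A A^o A^o *:%R (rmul_fun x) (@rmul_linear x).
Definition rmul x : {linear A^o -> A^o} := rmul_fun x.

Lemma rmulE x a : rmul x a = a * x. Proof. by []. Qed.

Definition principal x : set A^o := range (rmul x).

Lemma principal_submod x : submodule (principal x).
Proof. exact/image_submod/setT_submod. Qed.

(** The polynomial [e(u) = (1 - (1 - u)^k)^k] is divisible by [u^k] and
[1 - e(u)] by [(1 - u)^k], so [e(u)] is idempotent as soon as [(u(1-u))^k = 0];
it fixes the same [x] as [u], so it is not zero. *)
Lemma idem_poly u x k : u * x = x -> x != 0 -> (u * (1 - u)) ^+ k = 0 ->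
  exists c, let e := c * u in [/\ e * e = e & e != 0].
Proof.
move=> ux xn0 uk0.
have k0 : (0 < k)%N.
  case: k uk0 => // /eqP; rewrite expr0 => /eqP E.
  by case/eqP: xn0; rewrite -[x]mul1r E mul0r.
have cu1 : GRing.comm u (1 - u) by apply: commrB; [exact: commr1|].
pose z := (1 - u) ^+ k.
pose c1 := \sum_(i < k) (1 - u) ^+ i.
have zE : 1 - z = u * c1.
  by rewrite /z -opprB subrX1 -mulNr opprB subKr.
have cuc : GRing.comm u c1 by apply: commr_sum => i _; exact: commrX.
pose c2 := \sum_(i < k) (1 - z) ^+ i.
pose e := (1 - z) ^+ k.
have eE : e = u ^+ k * c1 ^+ k by rewrite /e zE exprMn_comm.
have e1 : 1 - e = z * c2.
  by rewrite /e -opprB subrX1 -mulNr opprB subKr.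
have ee : e * (1 - e) = 0.
  have eE' : e = c1 ^+ k * u ^+ k.
    by rewrite eE; apply: commrX; apply/commr_sym/commrX.
  rewrite e1 eE' mulrA -[_ * _ * z]mulrA /z -exprMn_comm // uk0.
  by rewrite mulr0 mul0r.
have ex : e * x = x.
  have zx : (1 - z) * x = x.
    rewrite mulrBl mul1r /z -[k]prednK // exprSr -mulrA mulrBl mul1r ux subrr.
    by rewrite mulr0 subr0.
  by rewrite /e; elim: (k) => [|n IH]; rewrite ?mul1r // exprSr -mulrA zx.
exists (u ^+ k.-1 * c1 ^+ k) => /=.
have -> : u ^+ k.-1 * c1 ^+ k * u = e.
  by rewrite eE -mulrA -(commrX k cuc) mulrA -exprSr prednK.
split; last by apply: contra_neq xn0 => e0; rewrite -ex e0 mul0r.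
by apply/eqP; rewrite eq_sym -subr_eq0 -{1}[e]mulr1 -mulrBr ee.
Qed.

Hypothesis hA : left_artinian A.

Lemma regular_min : min_condition A^o.
Proof. exact/(artinian_min hA)/regular_fg. Qed.

(** Let [L] be minimal among the left ideals inside [I] that have a non-nilpotent
element [y]. Then [L y = L], so [u y = y] for some [u] in [L], and [u (1 - u)] lies
in the annihilator of [y] in [L], a proper left ideal of [L] all of whose elements
are therefore nilpotent; [idem_poly] turns [u] into an idempotent. *)
Lemma idem_in_ideal I x : submodule I -> I x -> (forall n, x ^+ n != 0) ->
  exists u, [/\ I u, u * u = u & u != 0].
Proof.
move=> sI Ix xnil.
pose nonnil (L : set A^o) := exists2 y : A, L y & forall n, y ^+ n != 0.
have [||L [sL LI [y Ly ynil]] Lmin] :=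
    regular_min (F := [set L | [/\ submodule L, L `<=` I & nonnil L]]).
- by move=> L [].
- by exists I; split=> //; exists x.
have LyE : rmul y @` L = L.
  apply: Lmin; last by move=> _ [a La <-]; exact: ideal_mul.
  split; first exact: image_submod.
    by move=> _ [a La <-]; apply: ideal_mul => //; exact: LI.
  exists (y * y) => [|n]; first by exists y.
  by rewrite -expr2 -exprM.
have [u Lu uy] : exists2 u : A, L u & u * y = y.
  have : (rmul y @` L) y by rewrite LyE.
  by move=> [u Lu uy]; exists u.
pose N := [set a : A^o | L a /\ (a : A) * y = 0].
have [k] : exists k, (u * (1 - u)) ^+ k = 0.
  apply: contrapT => no.
  have NL : N = L.
    apply: Lmin; last by move=> a [].
    split.
    - split; first by split; [case: sL|exact: mul0r].
      move=> a b c [Lb by0] [Lc cy0]; split; first by case: sL => _; apply.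
      by rewrite /= mulrDl -mulrA by0 cy0 mulr0 addr0.
    - by move=> a [La _]; exact: LI.
    exists (u * (1 - u)) => [|n]; last by apply/eqP => E; apply: no; exists n.
    split; last by rewrite -mulrA mulrBl mul1r uy subrr mulr0.
    rewrite mulrBr mulr1; apply: (@submodB A A^o) => //; exact: ideal_mul.
  have [_ /eqP] : N u by rewrite NL.
  by rewrite uy; have := ynil 1%N; rewrite expr1 => /negPf ->.
have yn0 : y != 0 by have := ynil 1%N; rewrite expr1.
move=> /(idem_poly uy yn0) [c [ee en0]].
by exists (c * u); split=> //; apply/LI; exact: ideal_mul.
Qed.

(** [A g] is minimal among the nonzero left ideals generated by an idempotent:
[u * g = u] says that [A u] is contained in [A g]. *)
Definition min_idem g := [/\ g * g = g, g != 0 &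
  forall u, u * u = u -> u != 0 -> u * g = u -> exists b, g = b * u].

(** The left ideal [A g] is hollow: it is not the sum of two proper left
subideals. After scaling, [g = y1 + y2] with [yi] in [g A g]. If [y1] is not
nilpotent, [A y1] contains a nonzero idempotent, and [g] with it by minimality;
if it is, then [y2 = g - y1] is invertible in [g A g] by the geometric series. *)
Lemma min_idem_hollow g x1 x2 : min_idem g -> x1 * g = x1 -> x2 * g = x2 ->
  (exists b, g = b * (x1 + x2)) ->
  (exists b, g = b * x1) \/ (exists b, g = b * x2).
Proof.
move=> [gg gn0 gmin] x1g x2g [b gE].
pose y1 := g * b * x1; pose y2 := g * b * x2.
have yE : g = y1 + y2 by rewrite -mulrDr -mulrA -gE gg.
have [[n yn0]|nonnil] := pselect (exists n, y1 ^+ n = 0); last first.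
  have [||u [[a _ au] uu un0]] := idem_in_ideal (principal_submod x1) (x := y1).
  - by exists (g * b).
  - by move=> n; apply/eqP => E; apply: nonnil; exists n.
  have [|b' g'] := gmin u uu un0; first by rewrite -au rmulE -mulrA x1g.
  by left; exists (b' * a); rewrite g' -au rmulE mulrA.
have y2E : y2 = g - y1 by rewrite yE addrC addKr.
have y1g : y1 * g = y1 by rewrite /y1 -mulrA x1g.
have : g = (\sum_(i < n) y1 ^+ i) * y2 + y1 ^+ n * g.
  elim: n {yn0} => [|n IH]; first by rewrite big_ord0 mul0r add0r expr0 mul1r.
  rewrite {1}IH big_ord_recr /= mulrDl -addrA; congr (_ + _).
  by rewrite y2E mulrBr exprSr -mulrA y1g subrK.
rewrite yn0 mul0r addr0 => g'.
by right; exists ((\sum_(i < n) y1 ^+ i) * (g * b)); rewrite -mulrA.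
Qed.

Lemma min_idem_hollow_sum (T : eqType) (s : seq T) (F : T -> A) g :
  min_idem g -> (forall i, F i * g = F i) ->
  (exists b, g = b * \sum_(i <- s) F i) ->
  exists2 i, i \in s & exists b, g = b * F i.
Proof.
move=> mg Fg; elim: s => [|i s IH].
  by rewrite big_nil => -[b]; rewrite mulr0 => g0; case: mg; rewrite g0 eqxx.
rewrite big_cons => /(min_idem_hollow mg (Fg i))[|gi|/IH[j js gj]].
- by rewrite mulr_suml; apply: eq_bigr.
- by exists i => //; rewrite mem_head.
- by exists j => //; rewrite inE js orbT.
Qed.

(** An idempotent [g] generating a minimal left ideal inside [A e] need not satisfy
[e g = g], but [e g] is an idempotent that does and generates the same ideal. *)
Lemma exists_min_idem e : e * e = e -> e != 0 ->
  exists g, [/\ min_idem g, g * e = g & e * g = g].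
Proof.
move=> ee en0.
have [||_ [g [gg gn0 ge] <-] gmin] := regular_min
    (F := [set principal g | g in [set g : A | [/\ g * g = g, g != 0 & g * e = g]]]).
- by move=> _ [g _ <-]; exact: principal_submod.
- by exists (principal e), e.
have geg : g * (e * g) = g by rewrite mulrA ge gg.
exists (e * g); split; [|by rewrite -mulrA ge|by rewrite mulrA ee]; split.
- by rewrite -mulrA geg.
- by apply: contra_neq gn0 => eg0; rewrite -geg eg0 mulr0.
move=> u uu un0 ueg.
have ue : u * e = u by rewrite -ueg -!mulrA ge.
have ug : principal u `<=` principal g.
  by move=> _ [a _ <-]; exists (a * u * e) => //; rewrite !rmulE -!mulrA ueg.
have [b _ bu] : principal u g.
  rewrite (gmin (principal u)) //; last by exists u.
  by exists 1 => //; rewrite rmulE mul1r.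
by exists (e * b); rewrite -mulrA -[b * u]/(rmul u b) bu.
Qed.

End Idempotents.

(** * Quotient modules *)

Section QuotientModule.
Variables (A : pzRingType) (M : lmodType A) (N : set M) (sN : submodule N).

(** The proof argument lets the instance of an additive subgroup be found by
unification. *)
Definition submod_pred of submodule N : {pred M} := fun x => `[< N x >].

Fact submod_pred_zmod : GRing.zmod_closed (submod_pred sN).
Proof.
split=> [|x y /asboolP Nx /asboolP Ny]; first by apply/asboolP; case: sN.
by apply/asboolP; apply: submodB.
Qed.
HB.instance Definition _ := GRing.isZmodClosed.Build M (submod_pred sN) submod_pred_zmod.

Definition quotmod : Type := Quotient.quot (submod_pred sN : zmodClosed M).
HB.instance Definition _ := GRing.Zmodule.on quotmod.
Definition quot_proj (x : M) : quotmod :=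
  (\pi_(Quotient.quot (submod_pred sN : zmodClosed M)) x)%qT.

Lemma quot_proj_eq x y : quot_proj x = quot_proj y <-> N (x - y).
Proof.
split=> [/eqP|Nxy]; first by rewrite /quot_proj -Quotient.idealrBE => /asboolP.
by apply/eqP; rewrite /quot_proj -Quotient.idealrBE; apply/asboolP.
Qed.

Lemma quot_proj_surj (q : quotmod) : exists x, quot_proj x = q.
Proof. by exists (generic_quotient.repr q); exact: generic_quotient.reprK. Qed.

Lemma quot_projD x y : quot_proj (x + y) = quot_proj x + quot_proj y.
Proof. exact: Quotient.pi_add. Qed.

Definition quot_scale (a : A) (q : quotmod) : quotmod :=
  quot_proj (a *: (generic_quotient.repr q : M)).

Lemma quot_scaleE a x : quot_scale a (quot_proj x) = quot_proj (a *: x).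
Proof.
apply/quot_proj_eq; rewrite -scalerBr; apply: submodZ => //.
by apply/quot_proj_eq; exact: generic_quotient.reprK.
Qed.

Fact quot_scaleA a b q : quot_scale a (quot_scale b q) = quot_scale (a * b) q.
Proof. by have [x <-] := quot_proj_surj q; rewrite !quot_scaleE scalerA. Qed.
Fact quot_scale1 : left_id 1 quot_scale.
Proof. by move=> q; have [x <-] := quot_proj_surj q; rewrite quot_scaleE scale1r. Qed.
Fact quot_scaleDr : right_distributive quot_scale +%R.
Proof.
move=> a q q'; have [x <-] := quot_proj_surj q; have [y <-] := quot_proj_surj q'.
by rewrite -quot_projD !quot_scaleE -quot_projD scalerDr.
Qed.
Fact quot_scaleDl q : {morph quot_scale^~ q : a b / a + b}.
Proof.
by move=> a b; have [x <-] := quot_proj_surj q; rewrite !quot_scaleE -quot_projD scalerDl.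
Qed.

HB.instance Definition _ := GRing.Zmodule_isLmodule.Build A quotmod
  quot_scaleA quot_scale1 quot_scaleDr quot_scaleDl.

Fact quot_proj_linear : linear quot_proj.
Proof. by move=> a x y; rewrite quot_projD -quot_scaleE. Qed.
HB.instance Definition _ :=
  GRing.isLinear.Build A M quotmod *:%R quot_proj quot_proj_linear.

Lemma quotmod_fg : finitely_generated M -> finitely_generated (quotmod : lmodType A).
Proof.
move=> [n [g gM]]; exists n, (fun i => quot_proj (g i)) => q.
have [x <-] := quot_proj_surj q; have [c ->] := gM x; exists c.
by rewrite linear_sum; apply: eq_bigr => i _; rewrite linearZ.
Qed.

End QuotientModule.

(** * Kernels, cokernels and images in an abelian category *)

Section Preadditive.
Variable C : preadditive.
Implicit Types X Y Z K Q : C.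

Lemma comp0m X Y Z (f : hom X Y) : (0 : hom Y Z) \oc f = 0.
Proof. by apply: (addrI (0 \oc f)); rewrite -compDl !addr0. Qed.

Lemma compm0 X Y Z (g : hom Y Z) : g \oc (0 : hom X Y) = 0.
Proof. by apply: (addrI (g \oc 0)); rewrite -compDr !addr0. Qed.

Lemma compNm X Y Z (g : hom Y Z) (f : hom X Y) : (- g) \oc f = - (g \oc f).
Proof. by apply: (addrI (g \oc f)); rewrite -compDl !subrr comp0m. Qed.

Lemma compmN X Y Z (g : hom Y Z) (f : hom X Y) : g \oc (- f) = - (g \oc f).
Proof. by apply: (addrI (g \oc f)); rewrite -compDr !subrr compm0. Qed.

Lemma comp_sumr X Y Z I (s : seq I) (g : hom Y Z) (F : I -> hom X Y) :
  g \oc (\sum_(i <- s) F i) = \sum_(i <- s) g \oc F i.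
Proof.
by elim: s => [|i s IH]; rewrite ?big_nil ?compm0 // !big_cons compDr IH.
Qed.

Lemma cokernel_epic X Y Q (q : hom Y Q) (f : hom X Y) :
  is_cokernel q f -> epic q.
Proof.
move=> [qf0 qU] Z g h gh; have [|u [_ uU]] := qU _ (g \oc q).
  by rewrite -compA qf0 compm0.
by rewrite -(uU g) // -(uU h).
Qed.

Lemma monic0 X Y (f : hom X Y) :
  (forall T (t : hom T X), f \oc t = 0 -> t = 0) -> monic f.
Proof.
move=> f0 T g h fgh; apply/eqP; rewrite -subr_eq0; apply/eqP/f0.
by rewrite compDr compmN fgh subrr.
Qed.

Lemma kernel_short_exact K X Y Q (k : hom K X) (f : hom X Y) (q : hom X Q) :
  is_kernel k f -> is_cokernel q k -> short_exact k q.
Proof.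
move=> [fk0 kU] cq; split=> //; have [qk0 qU] := cq; split=> // T t qt0.
have [f' [f'q _]] := qU _ f fk0.
by apply: kU; rewrite -f'q -compA qt0 compm0.
Qed.

Hypothesis abC : abelian C.

Lemma monic_short_exact X Y (f : hom X Y) : monic f ->
  exists Z (g : hom Y Z), short_exact f g.
Proof.
move=> /(ab_monic abC)[W [h kh]]; have [Z [g cg]] := ab_cokernel abC f.
by exists Z, g; exact: kernel_short_exact kh cg.
Qed.

(** If [m t = 0] then [m] factors through the cokernel [p] of [t]. The epimorphism
[p q] is the cokernel of some [h], which [f] kills; so [h] factors through
[k] and [q h = 0]. Hence [q] factors through [p q], which makes [p] a split
monomorphism, and [p t = 0] gives [t = 0]. *)
Lemma coimage_monic K X Y Q (f : hom X Y) (k : hom K X) (q : hom X Q)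
    (m : hom Q Y) :
  is_kernel k f -> is_cokernel q k -> f = m \oc q -> monic m.
Proof.
move=> [fk0 kU] cq fE; apply: monic0 => T t mt0.
have [R [p cp]] := ab_cokernel abC t.
have [m' [m'p _]] := cp.2 _ m mt0.
have eq : epic q := cokernel_epic cq; have ep : epic p := cokernel_epic cp.
have epq : epic (p \oc q) by move=> Z g h; rewrite !compA => /eq /ep.
have [W [h ch]] := ab_epic abC epq.
have fh0 : f \oc h = 0 by rewrite fE -m'p -!compA [p \oc _]compA ch.1 compm0.
have [h' [h'k _]] := kU _ h fh0.
have [|y [yE _]] := ch.2 _ q; last first.
  have yp : y \oc p = idm Q by apply: eq; rewrite -compA yE comp1m.
  by rewrite -[t]comp1m -yp -compA cp.1 compm0.
by rewrite -h'k compA cq.1 comp0m.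
Qed.

Lemma image_factor X Y (f : hom X Y) : exists K Q (k : hom K X) (q : hom X Q)
  (m : hom Q Y), [/\ is_kernel k f, short_exact k q, monic m & f = m \oc q].
Proof.
have [K [k kk]] := ab_kernel abC f; have [Q [q cq]] := ab_cokernel abC k.
have [m [mE _]] := cq.2 _ f kk.1.
exists K, Q, k, q, m; split=> //; first exact: kernel_short_exact kk cq.
exact: coimage_monic kk cq (esym mE).
Qed.

End Preadditive.

Lemma additive_functor0 (C D : preadditive) (F : functor C D) (X Y : C) :
  additive_functor F -> fmap F (0 : hom X Y) = 0.
Proof. by move=> addF; apply: (addrI (fmap F 0)); rewrite -addF !addr0. Qed.

(** * The category of finitely generated modules *)

Section ModuleCategory.
Variable A : pzRingType.
Implicit Types M N P : fgmod A.

(** A morphism of [modf A] is a linear map only up to unfolding; naming the cast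
lets it be applied and keeps composites from being unfolded. *)
Definition lin M N (f : @hom (modf A) M N) : {linear M -> N} := f.

Lemma lin_ext M N (f g : @hom (modf A) M N) : lin f =1 lin g -> f = g.
Proof. exact: linmap_eq. Qed.

Lemma linD M N (f g : @hom (modf A) M N) x : lin (f + g) x = lin f x + lin g x.
Proof. by []. Qed.

Lemma linN M N (f : @hom (modf A) M N) x : lin (- f) x = - lin f x.
Proof. by []. Qed.

Lemma lin0 M N x : lin (0 : @hom (modf A) M N) x = 0.
Proof. by []. Qed.

Lemma lin1 M x : lin (@idm (modf A) M) x = x.
Proof. by []. Qed.

Lemma linM M N P (g : @hom (modf A) N P) (f : @hom (modf A) M N) x :
  lin (g \oc f) x = lin g (lin f x).
Proof. by []. Qed.

Lemma lin_sum M N I (s : seq I) (F : I -> @hom (modf A) M N) x :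
  lin (\sum_(i <- s) F i) x = \sum_(i <- s) lin (F i) x.
Proof. by elim: s => [|i s IH]; rewrite ?big_nil // !big_cons -IH. Qed.

Definition regmod : fgmod A := FgMod (@regular_fg A).

Definition point_fun M (x : M) (a : A^o) : M := (a : A) *: x.
Fact point_linear M (x : M) : linear (point_fun x).
Proof. by move=> a b c; rewrite /point_fun scalerDl scalerA. Qed.
HB.instance Definition _ M (x : M) :=
  GRing.isLinear.Build A A^o M *:%R (point_fun x) (point_linear x).
(** The morphism from [A] to [M] taking 1 to [x]; through it, elements of [M] are
morphisms from [A]. *)
Definition point M (x : M) : @hom (modf A) regmod M :=
  (point_fun x : {linear A^o -> M}).

Lemma pointE M (x : M) a : lin (point x) a = (a : A) *: x.
Proof. by []. Qed.

Lemma comp_point M N (f : @hom (modf A) M N) x : f \oc point x = point (lin f x).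
Proof. by apply: lin_ext => a; rewrite linM !pointE linearZ. Qed.

Lemma point1 M (f : @hom (modf A) regmod M) : point (lin f (1 : A^o)) = f.
Proof.
by apply: lin_ext => a; rewrite pointE -linearZ /= /GRing.scale /= mulr1.
Qed.

Lemma point_inj M : injective (@point M).
Proof.
move=> x y /(congr1 (fun f : @hom (modf A) regmod M => lin f (1 : A^o))).
by rewrite !pointE !scale1r.
Qed.

(** Otherwise the projection onto the quotient of [N] by the image of [f] would be
a nonzero map killing [f]. *)
Lemma epic_surj M N (f : @hom (modf A) M N) : epic f -> forall y, exists x, lin f x = y.
Proof.
move=> ef y; have sN := image_submod (lin f) (setT_submod M).
pose Q : fgmod A := FgMod (quotmod_fg sN (fgmod_fg N)).
pose q : @hom (modf A) N Q := (quot_proj sN : {linear N -> _}).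
have : q = 0.
  apply: ef; apply: lin_ext => x; rewrite !linM lin0.
  rewrite -[RHS](linear0 (quot_proj sN)); apply/quot_proj_eq; rewrite subr0.
  by exists x.
move=> /(congr1 (fun h => lin h y)); rewrite lin0 -[RHS](linear0 (quot_proj sN)).
by move=> /quot_proj_eq; rewrite subr0 => -[x _ <-]; exists x.
Qed.

Lemma kernel_inj K M N (k : @hom (modf A) K M) (f : @hom (modf A) M N) :
  is_kernel k f -> injective (lin k).
Proof.
move=> [fk0 kU] x y kxy.
have [|u [_ uU]] := kU _ (point (lin k x)).
  by rewrite comp_point -linM fk0; apply: lin_ext => a; rewrite pointE lin0 scaler0.
apply: point_inj; rewrite -(uU (point x)) ?comp_point //.
by rewrite -(uU (point y)) // comp_point kxy.
Qed.

(** The morphism [point x] factors through the kernel. *)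
Lemma kernel_exact K M N (k : @hom (modf A) K M) (f : @hom (modf A) M N) :
  is_kernel k f -> forall x, lin f x = 0 -> exists z, lin k z = x.
Proof.
move=> [_ kU] x fx0; have [|u [ku _]] := kU _ (point x).
  by rewrite comp_point fx0; apply: lin_ext => a; rewrite pointE lin0 scaler0.
exists (lin u (1 : A^o)); apply: point_inj.
by rewrite -comp_point point1.
Qed.

Section ExactFunctor.
Variables (C : preadditive) (v : functor C (modf A)).
Hypotheses (abC : abelian C) (exv : exact_functor v).

Lemma monic_inj X Y (f : @hom C X Y) : monic f -> injective (lin (fmap v f)).
Proof.
move=> /(monic_short_exact abC)[Z [g /exv.2[kf _]]]; exact: kernel_inj kf.
Qed.

Lemma image_of X Y (f : @hom C X Y) :
  exists (Q : C) (m : hom Q Y), injective (lin (fmap v m)) /\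
    range (lin (fmap v f)) = range (lin (fmap v m)).
Proof.
have [K [Q [k [q [m [_ /exv.2[_ cq] mm ->]]]]]] := image_factor abC f.
exists Q, m; split; first exact: monic_inj.
have sq := epic_surj (cokernel_epic cq).
rewrite fmapM; apply/seteqP; split=> [_ [x _ <-]|_ [y _ <-]].
  by exists (lin (fmap v q) x).
by have [x <-] := sq y; exists x.
Qed.

Lemma kernel_of X Y (f : @hom C X Y) :
  exists (K : C) (k : hom K X), injective (lin (fmap v k)) /\
    range (lin (fmap v k)) = [set x | lin (fmap v f) x = 0].
Proof.
have [K [Q [k [q [m [[fk0 _] /exv.2[kk _] mm fE]]]]]] := image_factor abC f.
exists K, k; split; first exact: kernel_inj kk.
apply/seteqP; split=> [_ [x _ <-]|x /= fx0].
  by rewrite /= -linM -fmapM fk0 (additive_functor0 _ _ exv.1).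
have [|z <-] := kernel_exact kk (x := x); last by exists z.
by apply: (monic_inj mm); rewrite linear0 -linM -fmapM -fE.
Qed.

End ExactFunctor.

End ModuleCategory.

(** * Homogeneous morphisms *)

Section Automorphisms.
Variable C : preadditive.

(** Stated for a functor equal to the identity, so that no transport along the
equalities of objects is needed. *)
Lemma id_functor_full_faithful (F : functor C C) : F = id_functor C ->
  forall M N (g : hom (F M) (F N)), exists2 f : hom M N, fmap F f = g &
    forall f', fmap F f' = g -> f' = f.
Proof. by move=> -> M N g; exists g. Qed.

(** Both composites of [S] with its inverse [T] are the identity: a lift [f] of
[T g] through [T S] satisfies [T (S f) = T g], and [T] is faithful since [S T] is. *)
Lemma aut_full_faithful (S : automorphism C) M N (g : hom (S M) (S N)) :
  exists f : hom M N, fmap S f = g.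
Proof.
have [f fE _] := id_functor_full_faithful (autK S) (fmap (aut_inv S) g : hom _ _).
exists f.
have [h _ hU] := id_functor_full_faithful (autVK S)
  (fmap S (fmap (aut_inv S) g) : hom _ _).
rewrite (hU g) // (hU (fmap S f)) //=.
by rewrite -[fmap (aut_inv S) _]/(fmap (aut_inv S \of S) f) fE.
Qed.

Lemma eqmK (X Y : C) (e : X = Y) : eqm (esym e) \oc eqm e = idm X.
Proof. by case: _ / e; rewrite compm1. Qed.

Lemma eqmVK (X Y : C) (e : X = Y) : eqm e \oc eqm (esym e) = idm Y.
Proof. by case: _ / e; rewrite compm1. Qed.

Lemma nt_inv_nat (D : preadditive) (F G : functor C D) (a : nat_iso F G)
    (M N : C) (f : hom M N) : nt_inv a N \oc fmap G f = fmap F f \oc nt_inv a M.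
Proof.
rewrite -[LHS]compm1 -(ntVK a) [_ \oc (a M \oc _)]compA -[(_ \oc _) \oc a M]compA.
by rewrite -nt_nat !compA ntK comp1m.
Qed.

End Automorphisms.

Section Homogeneous.
Variables (B : preadditive) (X : cover_data B).
Local Notation C := (cv_cat X).
Local Notation S := (cv_shift X).
Local Notation v := (cv_fun X).
Local Notation eps := (cv_eps X).
Implicit Types M N P : C.

Definition eps_hom M : hom (v M) (v (S M)) := eps M.
Definition eps_inv M : hom (v (S M)) (v M) := nt_inv eps M.

Lemma epsK M : eps_inv M \oc eps_hom M = idm (v M).
Proof. exact: (ntK eps M). Qed.

Lemma epsVK M : eps_hom M \oc eps_inv M = idm (v (S M)).
Proof. exact: (ntVK eps M). Qed.

Lemma eps_nat M N (f : hom M N) :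
  eps_hom N \oc fmap v f = fmap v (fmap S f) \oc eps_hom M.
Proof. exact: (nt_nat eps f). Qed.

Lemma eps_inv_nat M N (f : hom M N) :
  eps_inv N \oc fmap v (fmap S f) = fmap v f \oc eps_inv M.
Proof. exact: (nt_inv_nat eps f). Qed.

Lemma unshift_posS N n :
  unshift_pos N n.+1 = unshift_pos N n \oc eps_inv (iter n S N).
Proof. by []. Qed.

Definition shiftK Y : S (aut_inv S Y) = Y :=
  congr1 (fun F : functor C C => F Y) (autVK S).

Lemma unshift_negS N n : unshift_neg N n.+1 = unshift_neg N n \oc
  (fmap v (eqm (shiftK (iter n (aut_inv S) N))) \oc eps_hom (iter n.+1 (aut_inv S) N)).
Proof. by []. Qed.

(** The image of the summand [Hom(M, N[i])] in [Hom(vM, vN)]. *)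
Definition of_degree (i : int) M N (f : hom (v M) (v N)) : Prop :=
  exists f' : hom M (aut_pow S i N), f = unshift N i \oc fmap v f'.

Lemma of_degree_fmap M N (f : hom M N) : of_degree 0 (fmap v f).
Proof. by exists f; rewrite comp1m. Qed.

Lemma of_degree1 M : of_degree 0 (idm (v M)).
Proof. by rewrite -(fmap1 v); exact: of_degree_fmap. Qed.

Lemma of_degree_comp_fmap i L M N (f : hom (v M) (v N)) (g : hom L M) :
  of_degree i f -> of_degree i (f \oc fmap v g).
Proof. by move=> [f' ->]; exists (f' \oc g); rewrite fmapM compA. Qed.

(** [N[i]][1] and [N[i+1]] are isomorphic compatibly with the identifications of
their images with [vN]; for negative [i] this is the equality [Y[-1][1] = Y]. *)
Lemma shift_succ N i j : j = i + 1 ->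
  exists (a : hom (S (aut_pow S i N)) (aut_pow S j N))
    (b : hom (aut_pow S j N) (S (aut_pow S i N))),
  [/\ b \oc a = idm _, a \oc b = idm _ &
    unshift N j \oc fmap v a = unshift N i \oc eps_inv (aut_pow S i N)].
Proof.
move=> ->; case: i => n.
  have -> : Posz n + 1 = Posz n.+1 by rewrite intS addrC.
  exists (idm _), (idm _); rewrite compm1; split=> //.
  by rewrite fmap1 compm1.
case: n => [|n].
  exists (eqm (shiftK N)), (eqm (esym (shiftK N))).
  rewrite eqmK eqmVK; split=> //.
  by rewrite [unshift N (Negz 0)]unshift_negS /= !comp1m -compA epsVK compm1.
have -> : Negz n.+1 + 1 = Negz n by rewrite !NegzE intS opprD addrAC addNr add0r.
pose Y := iter n.+1 (aut_inv S) N.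
exists (eqm (shiftK Y)), (eqm (esym (shiftK Y))); rewrite eqmK eqmVK; split=> //.
by rewrite [unshift N (Negz n.+1)]unshift_negS -/Y -!compA epsVK compm1.
Qed.

(** Shifting the source raises the degree by one. The degrees of [epsilon] and of
composites follow from this step, used in both directions. *)
Lemma of_degree_succ i j M N (f : hom (v M) (v N)) : j = i + 1 ->
  of_degree i f <-> of_degree j (f \oc eps_inv M).
Proof.
move=> ij; have [a [b [ba ab uE]]] := shift_succ N ij; split=> [[f' ->]|[g gE]].
  exists (a \oc fmap S f'); rewrite fmapM [RHS]compA uE -!compA.
  by rewrite eps_inv_nat.
have [f' f'E] := aut_full_faithful (b \oc g).
exists f'; rewrite -[f]compm1 -epsK compA gE.
have -> : g = a \oc fmap S f' by rewrite f'E compA ab comp1m.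
rewrite fmapM [unshift N j \oc _]compA uE -!compA -eps_nat.
by rewrite [eps_inv _ \oc _]compA epsK comp1m.
Qed.

Lemma of_degree_eps_inv M : of_degree 1 (eps_inv M).
Proof.
by rewrite -[eps_inv M]comp1m; apply/(@of_degree_succ 0) => //; exact: of_degree1.
Qed.

Lemma of_degree_eps M : of_degree (- 1) (eps_hom M).
Proof.
by apply/(@of_degree_succ _ 0) => //; rewrite epsVK; exact: of_degree1.
Qed.

(** Induction on [i]: one shift of the source at a time, by [of_degree_succ]. *)
Lemma of_degree_unshift i j k N P (g : hom (v N) (v P)) : k = i + j ->
  of_degree j g -> of_degree k (g \oc unshift N i).
Proof.
move=> -> gj; case: i => n.
  elim: n => [|n IH]; first by rewrite compm1 add0r.
  rewrite [unshift _ _]unshift_posS compA; apply: (iffLR (of_degree_succ _ _)) IH.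
  by rewrite intS -addrA addrC.
suff : forall n, of_degree (- n%:Z + j) (g \oc unshift_neg N n).
  by move=> /(_ n.+1); rewrite NegzE.
elim=> [|m IH]; first by rewrite /= compm1 oppr0 add0r.
rewrite unshift_negS !compA; apply/(@of_degree_succ _ (- m%:Z + j)).
  by rewrite intS opprD [RHS]addrC -[_ - _ + j]addrA addNKr.
by rewrite -compA epsVK compm1; exact: of_degree_comp_fmap.
Qed.

Lemma of_degreeM i j k M N P (g : hom (v N) (v P)) (f : hom (v M) (v N)) :
  k = i + j -> of_degree j g -> of_degree i f -> of_degree k (g \oc f).
Proof.
move=> kE gj [f' ->]; rewrite compA; apply: of_degree_comp_fmap.
exact: of_degree_unshift kE gj.
Qed.

Lemma unshift_monic N i : exists u, u \oc unshift N i = idm (v (aut_pow S i N)).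
Proof.
case: i => n.
  elim: n => [|n [u uE]]; first by exists (idm _); rewrite compm1.
  exists (eps_hom _ \oc u).
  rewrite [unshift _ _]unshift_posS -compA [u \oc _]compA uE comp1m.
  exact: epsVK.
suff : forall n, exists u, u \oc unshift_neg N n = idm _ by exact.
elim=> [|m [u uE]]; first by exists (idm _); rewrite compm1.
exists (eps_inv _ \oc (fmap v (eqm (esym (shiftK _))) \oc u)).
rewrite unshift_negS -!compA [u \oc _]compA uE comp1m.
by rewrite [fmap _ _ \oc (_ \oc _)]compA -fmapM eqmK fmap1 comp1m epsK.
Qed.

Hypothesis hX : graded_cover X.

Lemma fmapD M N (f g : hom M N) : fmap v (f + g) = fmap v f + fmap v g.
Proof. exact: (gc_exact hX).1. Qed.

Lemma fmap0 M N : fmap v (0 : hom M N) = 0.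
Proof. exact: (additive_functor0 _ _ (gc_exact hX).1). Qed.

Lemma fmapN M N (f : hom M N) : fmap v (- f) = - fmap v f.
Proof. by apply: (addrI (fmap v f)); rewrite -fmapD !subrr fmap0. Qed.

Lemma of_degree_zero i M N : of_degree i (0 : hom (v M) (v N)).
Proof. by exists 0; rewrite fmap0 compm0. Qed.

Lemma of_degreeB i M N (f g : hom (v M) (v N)) :
  of_degree i f -> of_degree i g -> of_degree i (f - g).
Proof.
by move=> [f' ->] [g' ->]; exists (f' - g'); rewrite fmapD fmapN compDr compmN.
Qed.

Definition components M N (f : hom (v M) (v N)) (c : int -> hom (v M) (v N)) :=
  [/\ forall i, of_degree i (c i), finite_set [set i | c i != 0]
    & f = \sum_(i \in [set: int]) c i].

Lemma of_degree_components M N (f : hom (v M) (v N)) : exists c, components f c.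
Proof.
have [g fg gf] := gc_hom hX M N; pose h := g f.
exists (fun i => unshift N i \oc fmap v (sval h i)); split.
- by move=> i; exists (sval h i).
- apply: sub_finite_set (svalP h) => i /=; apply: contra_neq => ->.
  by rewrite fmap0 compm0.
- by rewrite -[LHS]gf.
Qed.

(** Two families of components come from two elements of the direct sum of the
[Hom(M, N[i])] with the same image in [Hom(vM, vN)]. A zero component must be
lifted by zero, to keep the support finite. *)
Lemma components_uniq M N (f : hom (v M) (v N)) c d :
  components f c -> components f d -> c = d.
Proof.
have lift e : components f e -> exists h : graded_hom M N,
    total_hom h = f /\ forall i, e i = unshift N i \oc fmap v (sval h i).
  move=> [eD efin eE].
  have [h hE] : exists h : forall i, hom M (aut_pow S i N), forall i,
      e i = unshift N i \oc fmap v (h i) /\ (e i = 0 -> h i = 0).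
    suff hP i : {f' : hom M (aut_pow S i N) |
        e i = unshift N i \oc fmap v f' /\ (e i = 0 -> f' = 0)}.
      by exists (fun i => sval (hP i)) => i; exact: svalP (hP i).
    apply: cid; have [ei0|/eqP ei0] := eqVneq (e i) 0.
      by exists 0; rewrite fmap0 compm0.
    by have [f' f'E] := eD i; exists f'; split.
  have hfin : finite_set [set i | h i != 0].
    by apply: sub_finite_set efin => i /=; apply: contra_neq => /(hE i).2.
  exists (exist _ h hfin); split=> [|i]; last exact: (hE i).1.
  rewrite eE /total_hom; apply: eq_fsbigr => i _ /=; by rewrite (hE i).1.
move=> /lift[h [hE ch]] /lift[h' [h'E dh]].
have [g fg _] := gc_hom hX M N.
apply/funext => i; rewrite ch dh; congr (unshift N i \oc fmap v (sval _ i)).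
by rewrite -[h]fg -[h']fg hE h'E.
Qed.

End Homogeneous.

(** * Homogeneous components *)

Lemma finite_int_seq (D : set int) : finite_set D ->
  exists2 s : seq int, uniq s & forall i, (i \in s) <-> D i.
Proof.
move=> /finite_seqP[s ->]; exists (undup s); first exact: undup_uniq.
by move=> i; rewrite mem_undup.
Qed.

Section FiniteSupport.
Variable V : zmodType.
Implicit Types c : int -> V.

Lemma finsum_seq c (s : seq int) : uniq s -> (forall i, c i != 0 -> i \in s) ->
  \sum_(i \in [set: int]) c i = \sum_(i <- s) c i.
Proof.
move=> us cs; rewrite (fsbigE s) // => [|i _ is0].
  by under eq_bigl do rewrite in_setT.
by apply: contraNeq is0; exact: cs.
Qed.

Lemma finite_support_escape c i d : finite_set [set i | c i != 0] -> d != 0 ->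
  exists k : nat, c (i + d *+ k) = 0.
Proof.
move=> fc d0; apply: contrapT => no; apply: infinite_nat.
have -> : [set: nat] = (fun k : nat => i + d *+ k) @^-1` [set i | c i != 0].
  apply/seteqP; split=> // k _ /=; apply/eqP => ck0.
  by apply: no; exists k.
by apply: finite_preimage fc => k l _ _ /addrI /(Num.Theory.mulrIn d0).
Qed.

End FiniteSupport.

Section Components.
Variables (B : preadditive) (X : cover_data B) (hX : graded_cover X).
Local Notation C := (cv_cat X).
Local Notation v := (cv_fun X).
Implicit Types M N P : C.

Lemma components_delta i M N (f : hom (v M) (v N)) : of_degree i f ->
  components f (fun j => if j == i then f else 0).
Proof.
move=> fi; split.
- by move=> j; case: eqP => [->|_] //; exact: of_degree_zero.
- apply: sub_finite_set (finite_set1 i) => j /=.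
  by case: (eqVneq j i) => //; rewrite eqxx.
rewrite (finsum_seq (s := [:: i])) => [|//|j]; first by rewrite big_seq1 eqxx.
by rewrite inE; case: (eqVneq j i) => //; rewrite eqxx.
Qed.

Lemma componentsB M N (f g : hom (v M) (v N)) c d :
  components f c -> components g d -> components (f - g) (fun i => c i - d i).
Proof.
move=> [cD cfin cE] [dD dfin dE].
have fin : finite_set ([set i | c i != 0] `|` [set i | d i != 0]).
  by rewrite finite_setU.
have sub i : c i - d i != 0 -> ([set i | c i != 0] `|` [set i | d i != 0]) i.
  have [->|c0 _] := eqVneq (c i) 0; last by left.
  by rewrite sub0r oppr_eq0; right.
split; first by move=> i; exact: of_degreeB.
  exact: sub_finite_set fin.
have [s us sP] := finite_int_seq fin.
rewrite cE dE !(finsum_seq us) ?sumrB // => i /= ci0; apply/sP.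
all: by [exact: sub|left|right].
Qed.

Lemma components_comp d M N P (w : hom (v N) (v P)) (f : hom (v M) (v N)) c :
  of_degree d w -> components f c ->
  components (w \oc f) (fun i => w \oc c (i - d)).
Proof.
move=> wd [cD cfin cE]; split.
- by move=> i; apply: of_degreeM wd (cD _); rewrite subrK.
- have fin : finite_set ((fun i => i - d) @^-1` [set i | c i != 0]).
    by apply: finite_preimage cfin => i j _ _; exact: addIr.
  apply: sub_finite_set fin => i /=; apply: contra_neq => ->.
  exact: compm0.
have -> : \sum_(i \in [set: int]) (w \oc c (i - d)) =
    \sum_(i \in [set: int]) (w \oc c i).
  symmetry; apply: (reindex_fsbigT (fun i : int => i - d)).
  by exists (fun i => i + d) => i; rewrite ?subrK ?addrK.
have [s us sP] := finite_int_seq cfin.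
rewrite cE !(finsum_seq us) ?comp_sumr // => i ci0; apply/sP => //=.
by apply: contra_neq ci0 => ->; exact: compm0.
Qed.

Fixpoint comp_pow N (w : hom (v N) (v N)) (k : nat) : hom (v N) (v N) :=
  if k is k'.+1 then w \oc comp_pow w k' else idm _.

Lemma comp_powS N (w : hom (v N) (v N)) k : comp_pow w k.+1 = w \oc comp_pow w k.
Proof. by []. Qed.

Lemma of_degree_pow N d (w : hom (v N) (v N)) k :
  of_degree d w -> of_degree (d *+ k) (comp_pow w k).
Proof.
move=> wd; elim: k => [|k IH] /=; first exact: of_degree1.
by apply: of_degreeM wd IH; rewrite mulrS addrC.
Qed.

(** Comparing components, [c i = w c (i - d)]. So a nonzero component would make
the components nonzero along an infinite progression of degrees. *)
Lemma of_degree_fixed d M N (w : hom (v N) (v N)) (f : hom (v M) (v N)) :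
  d != 0 -> of_degree d w -> w \oc f = f -> f = 0.
Proof.
move=> d0 wd wf; have [c cf] := of_degree_components hX f.
have cE i : c i = w \oc c (i - d).
  have := components_comp wd cf; rewrite wf => cf'.
  by rewrite {1}(components_uniq hX cf cf').
case: (cf) => _ cfin ->; apply: fsbig1 => i _.
have [|k] := @finite_support_escape _ c i (- d) cfin; first by rewrite oppr_eq0.
elim: k i => [|k IH] i; first by rewrite mulr0n addr0.
rewrite mulrS addrA => /IH ci; by rewrite cE ci compm0.
Qed.

(** The components of [h] satisfy [c i = w c (i - d)] for [i != 0], so those of
degree [-d], [-2d], ... vanish as in [of_degree_fixed]. Hence [c 0 = 1] and
[c (k d) = w^k]: the inverse of [1 - w] is the geometric series, which must be
finite. *)
Lemma of_degree_right_inverse d N (w h : hom (v N) (v N)) :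
  d != 0 -> of_degree d w -> (idm _ - w) \oc h = idm _ -> exists k, comp_pow w k = 0.
Proof.
move=> d0 wd wh; have [c ch] := of_degree_components hX h.
have cE i : c i = w \oc c (i - d) + (if i == 0 then idm _ else 0).
  have hE : idm (v N) = h - w \oc h by rewrite -wh compDl compNm comp1m.
  have := componentsB ch (components_comp wd ch); rewrite -hE => /(components_uniq hX) E.
  have := components_delta (of_degree1 N) => /E /(congr1 (fun c => c i)) /= <-.
  by rewrite addrC subrK.
case: (ch) => _ cfin _.
have cNd k : c (- d *+ k.+1) = w \oc c (- d *+ k.+2).
  rewrite cE addrC ifF; first by rewrite add0r [_ *+ k.+2]mulrSr.
  by apply/negbTE; rewrite -mulr_natr mulf_neq0 ?oppr_eq0 // Num.Theory.pnatr_eq0.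
have c0 : c 0 = idm _.
  rewrite cE eqxx sub0r; suff -> : c (- d) = 0 by rewrite compm0 add0r.
  have [|k] := @finite_support_escape _ c (- d) (- d) cfin; first by rewrite oppr_eq0.
  have := cNd; rewrite -mulrS => {}cNd; elim: k => // k IH ck.
  by apply: IH; rewrite cNd ck compm0.
have cpow k : c (d *+ k) = comp_pow w k.
  elim: k => //= k IH; rewrite cE ifF; first by rewrite addr0 mulrSr addrK IH.
  by apply/negbTE; rewrite -mulr_natr mulf_neq0 // Num.Theory.pnatr_eq0.
have [k] := @finite_support_escape _ c 0 d cfin d0.
by rewrite add0r cpow => wk; exists k.
Qed.

End Components.

(** * Endomorphisms of nonzero degree are nilpotent *)

Section Nilpotent.
Variables (A : pzRingType) (hA : left_artinian A).
Variables (X : cover_data (modf A)) (hX : graded_cover X).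
Local Notation C := (cv_cat X).
Local Notation v := (cv_fun X).

Lemma fgmod_min (M : fgmod A) : min_condition M.
Proof. exact/(artinian_min hA)/fgmod_fg. Qed.

Lemma lin_comp_pow (N : C) (w : hom (v N) (v N)) k x :
  lin (comp_pow w k) x = iter k (lin w) x.
Proof. by elim: k => // k IH; rewrite comp_powS linM IH. Qed.

(** The second axiom of a graded cover for the epimorphism from [A] to the image
of a zero object. *)
Lemma cover_regular : exists (P : C) (p : hom (v P) (regmod A)),
  forall x, exists y, lin p y = x.
Proof.
have [Z Z0] := ab_zero (gc_abelian hX).
have vZ0 W (f : hom (v Z) W) : f = 0.
  by rewrite -[f]compm1 -(fmap1 v) ((Z0 Z).1 (idm Z)) (fmap0 hX) compm0.
have [|P [p [_ [ep _]]]] := gc_epi hX (M := regmod A) (N := Z) (f := 0).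
  by move=> W g h _; rewrite (vZ0 _ g) (vZ0 _ h).
by exists P, p; exact: epic_surj ep.
Qed.

(** The map [1 - w] is injective, because every element of [vN] is in the image
of a map from some [vP] and [of_degree_fixed] applies; so it is bijective by the
descending chain condition, and [of_degree_right_inverse] applies to its inverse. *)
Lemma of_degree_nilpotent d (N : C) (w : hom (v N) (v N)) : d != 0 -> of_degree d w ->
  exists k, forall x, iter k (lin w) x = 0.
Proof.
move=> d0 wd; have [P [p psurj]] := cover_regular.
have inj : injective (lin (idm (v N) - w)).
  move=> x y xy; pose z := x - y.
  have wz : lin w z = z.
    have : lin (idm (v N) - w) z = 0 by rewrite linearB xy subrr.
    by rewrite linD linN lin1 => /eqP; rewrite subr_eq0 => /eqP.
  have zp0 : point z \oc p = 0.
    by apply: (of_degree_fixed hX d0 wd); rewrite compA comp_point wz.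
  have [e eE] := psurj (1 : A^o).
  apply/eqP; rewrite -subr_eq0; apply/eqP.
  by have := congr1 (fun f => lin f e) zp0; rewrite linM eE pointE scale1r.
have surj := inj_surj (@fgmod_min (v N)) inj.
have [h hE] := choice surj.
have hlin : linear h.
  by move=> a x y; apply: inj; rewrite linearP !hE.
pose hl : {linear v N -> v N} := HB.pack h (GRing.isLinear.Build _ _ _ _ h hlin).
have [|k wk] := @of_degree_right_inverse _ _ hX d N w hl d0 wd.
  by apply: lin_ext => x; rewrite linM lin1 -[RHS]hE.
by exists k => x; rewrite -lin_comp_pow wk lin0.
Qed.

End Nilpotent.

(** * Lifting the regular module *)

Section Lifting.
Variables (A : pzRingType) (hA : left_artinian A).
Variables (X : cover_data (modf A)) (hX : graded_cover X).
Local Notation C := (cv_cat X).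
Local Notation v := (cv_fun X).
Local Notation R := (regmod A : obj (modf A)).
Implicit Types Q I : C.

Let exv := gc_exact hX.
Let abC := gc_abelian hX.

Lemma lin_comp_id (M N : fgmod A) (u : @hom (modf A) N M) (f : @hom (modf A) M N) :
  u \oc f = idm _ -> injective (lin f).
Proof.
by move=> uf; apply: (can_inj (g := lin u)) => x; rewrite -linM uf lin1.
Qed.

Lemma of_degree_image d I Q (w : hom (v I) (v Q)) : of_degree d w ->
  exists (K : C) (m : hom (v K) (v Q)),
    [/\ of_degree d m, injective (lin m) & range (lin w) = range (lin m)].
Proof.
move=> [w' ->]; have [K [m [im rm]]] := image_of abC exv w'.
have [u uE] := unshift_monic Q d; have iu := lin_comp_id uE.
exists K, (unshift Q d \oc fmap v m); split; first by exists m.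
  by move=> x y; rewrite !linM => /iu /im.
apply/seteqP; split=> _ [x _ <-].
  have : range (lin (fmap v w')) (lin (fmap v w') x) by exists x.
  by rewrite rm => -[y _ yE]; exists y => //; rewrite !linM yE.
have : range (lin (fmap v m)) (lin (fmap v m) x) by exists x.
by rewrite -rm => -[y _ yE]; exists y => //; rewrite !linM yE.
Qed.

Lemma of_degree_kernel d I Q (w : hom (v I) (v Q)) : of_degree d w ->
  exists (K : C) (k : hom (v K) (v I)),
    [/\ of_degree 0 k, injective (lin k) & range (lin k) = [set x | lin w x = 0]].
Proof.
move=> [w' ->]; have [K [k [ik rk]]] := kernel_of abC exv w'.
have [u uE] := unshift_monic Q d; have iu := lin_comp_id uE.
exists K, (fmap v k); split=> //; first exact: of_degree_fmap.
rewrite rk; apply/eq_set => x; apply/propext; rewrite linM.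
split=> [->|]; first exact: linear0.
by rewrite -[RHS](linear0 (lin (unshift Q d))) => /iu.
Qed.

(** The object [vQ] is then isomorphic to the left ideal [A e], as the image of
right multiplication by [e]. *)
Definition lifts (e : A) := exists Q (s : hom R (v Q)) (r : hom (v Q) R),
  s \oc r = idm (v Q) /\ r \oc s = point (e : R).

(** Among the images in [vP] of injective homogeneous maps, consider those that
the given surjection [vP -> A g] still maps onto [A g], and choose a minimal one.
The first two conclusions say that the image of [r] is exactly [A g]. *)
Lemma exists_min_onto (g : A) : g * g = g ->
  exists Q (r : hom (v Q) R),
  [/\ exists q, lin r q = g, point (g : R) \oc r = r &
    forall I d (m : hom (v I) (v Q)), of_degree d m -> injective (lin m) ->
      (exists x, lin r (lin m x) = g) -> forall y, exists x, lin m x = y].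
Proof.
move=> gg; have [P [p psurj]] := cover_regular hX.
pose r0 := point (g : R) \oc p.
pose F := [set N | exists I d (j : hom (v I) (v P)),
  [/\ of_degree d j, injective (lin j), exists x, lin r0 (lin j x) = g
    & N = range (lin j)]].
have [||N [Q [d [j [jd ij [q qg] NE]]]] Nmin] := @fgmod_min A hA (v P) F.
- by move=> _ [I [d [j [_ _ _ ->]]]]; exact/image_submod/setT_submod.
- have [x xE] := psurj (1 : A^o).
  exists (range (lin (idm (v P)))), P, 0, (idm _); split=> //.
    exact: of_degree1.
  by exists x; rewrite linM lin1 xE pointE scale1r.
exists Q, (r0 \oc j); split.
- by exists q.
- rewrite compA; congr comp; rewrite /r0 compA comp_point; congr comp.
  by congr point; exact: gg.
move=> I e m me im [x xE] y.
have E : range (lin (j \oc m)) = N.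
  apply: Nmin; last by rewrite NE => _ [z _ <-]; exists (lin m z).
  exists I, (e + d), (j \oc m); split=> //.
  - exact: of_degreeM jd me.
  - by move=> a b; rewrite !linM => /ij /im.
  - by exists x.
have [z _ /ij zE] : range (lin (j \oc m)) (lin j y) by rewrite E NE; exists y.
by exists z.
Qed.

(** The object [Q] of [exists_min_onto] works. The surjection [r] splits by some
[s], and the complementary idempotent [del = 1 - s r] is the sum of its homogeneous
components. By [nil_words_idem] it vanishes as soon as all words in the
components are nilpotent, which follows from hollowness of [A g] and minimality
of [Q]. *)
Lemma lift_min_idem (g : A) : min_idem g -> lifts g.
Proof.
move=> mg; have [gg gn0 _] := mg.
have [Q [r [[q rq] gr Qmin]]] := exists_min_onto gg.
have rg x : (lin r x : A) * g = lin r x by rewrite -{2}gr.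
pose s : @hom (modf A) R (v Q) := point q.
have rs : r \oc s = point (g : R) by rewrite comp_point rq.
exists Q, s, r; split=> //.
pose del := idm (v Q) - s \oc r.
have rdel : r \oc del = 0.
  by rewrite compDr compm1 compmN compA rs gr subrr.
have ddel : del \oc del = del.
  by rewrite {1}/del compDl comp1m compNm -compA rdel compm0 subr0.
suff del0 x : lin del x = 0.
  apply/eqP; rewrite eq_sym -subr_eq0; apply/eqP.
  by apply: lin_ext => x; exact: del0.
have [c [cD cfin cE]] := of_degree_components hX del.
have [J uJ JP] := finite_int_seq cfin.
have delE y : lin del y = \sum_(i <- J) lin (c i) y.
  by rewrite {1}cE (finsum_seq uJ) ?lin_sum // => i /JP.
(* In nonzero degree a component is nilpotent; if its composite with r were onto
   A g, its image would be all of vQ by minimality. *)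
have letter i x' : i != 0 -> lin r (lin (c i) x') <> g.
  move=> i0 rc; have [K [m [md im rm]]] := of_degree_image (cD i).
  have [k nk] := of_degree_nilpotent hA hX i0 (cD i).
  have csurj y : exists x, lin (c i) x = y.
    have [|z <-] := Qmin _ _ _ md im _ y.
      have : range (lin (c i)) (lin (c i) x') by exists x'.
      by rewrite rm => -[z _ zE]; exists z; rewrite zE.
    have : range (lin m) (lin m z) by exists z.
    by rewrite -rm => -[t _ tE]; exists t.
  have [t tq] : exists t, iter k (lin (c i)) t = q.
    elim: k {nk} => [|k [t <-]]; first by exists q.
    by have [t' <-] := csurj t; exists t'; rewrite -iterSr.
  case/eqP: gn0; rewrite -rq -tq nk; exact: linear0.
have word_of_degree w : word J (fun i => lin (c i)) w ->
    exists d (f : hom (v Q) (v Q)), [/\ of_degree d f, lin f = w &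
      forall x, lin r (w x) <> g].
  elim=> {w} [i iJ|u1 u2 _ [d1 [f1 [f1d <- n1]]] _ [d2 [f2 [f2d <- _]]]].
    exists i, (c i); split=> // x' rc.
    have [i0|i0] := eqVneq i 0; last exact: letter rc.
    (* In degree 0, since r del = 0, the element g is minus a sum of values of the
       other composites, and hollowness makes one of these onto A g. *)
    have : exists b, g = b * \sum_(j <- J | j != 0) (lin r (lin (c j) x') : A).
      exists (-1); have := congr1 (fun f => lin f x') rdel.
      rewrite linM delE lin0 linear_sum (bigD1_seq i) //= rc i0 => /eqP.
      by rewrite addr_eq0 mulN1r => /eqP.
    rewrite -big_filter => /(min_idem_hollow_sum hA mg)[|j].
    - by move=> j; exact: rg.
    rewrite mem_filter => /andP[j0 _] [b gb].
    by apply: (letter j (b *: x') j0); rewrite !linearZ.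
  exists (d2 + d1), (f1 \oc f2); split=> //; first exact: of_degreeM f1d f2d.
  by move=> y; exact: n1.
apply: (nil_words_idem (@fgmod_min A hA (v Q)) _ (fgmod_fg (v Q)) delE); last first.
  by move=> y; rewrite -linM ddel.
move=> _ /word_of_degree[d [f [fd <- nf]]].
(* The image of f^n does not map onto A g, so its kernel does, and by minimality
   the kernel is everything. *)
have [n n0 nst] := iter_stab (lin f) (@fgmod_min A hA (v Q)).
exists n; have [K [k [k0 ik rk]]] := of_degree_kernel (of_degree_pow n fd).
suff ksurj y : exists x, lin k x = y.
  move=> y; rewrite -lin_comp_pow; have [z <-] := ksurj y.
  have : range (lin k) (lin k z) by exists z.
  by rewrite rk.
apply: Qmin k0 ik _ y.
have [y' yE] := nst q; set y1 := iter n (lin f) y' in yE.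
have ker : lin (comp_pow f n) (q - y1) = 0.
  by rewrite lin_comp_pow iterB_lin yE subrr.
have : exists b, g = b * (lin r y1 + lin r (q - y1) : A).
  by exists 1; rewrite mul1r -linearD addrC subrK rq.
case/(min_idem_hollow hA mg (rg _) (rg _)) => [[b gb]|[b gb]].
  case: (nf (iter n.-1 (lin f) (b *: y'))).
  rewrite -iterS prednK // gb -[RHS]/(b *: (lin r y1)) -linearZ; congr (lin r _).
  by rewrite /y1; elim: (n) => //= m ->; rewrite linearZ.
have : range (lin k) (b *: (q - y1)).
  apply: submodZ; first exact/image_submod/setT_submod.
  by rewrite rk.
by move=> [y2 _ y2E]; exists y2; rewrite y2E linearZ.
Qed.

Lemma lifts0 : lifts 0.
Proof.
have [Z Z0] := ab_zero abC.
exists Z, 0, 0; rewrite !compm0; split.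
  by rewrite -(fmap1 v) ((Z0 Z).1 (idm Z)) (fmap0 hX).
by apply: lin_ext => a; rewrite pointE lin0 scaler0.
Qed.

Lemma point_comp (a b : A) :
  point (b : R) \oc point (a : R) = point (a * b : R).
Proof. by rewrite comp_point pointE. Qed.

Lemma liftsD (e f : A) : e * f = 0 -> f * e = 0 ->
  lifts e -> lifts f -> lifts (e + f).
Proof.
move=> ef fe [Q1 [s1 [r1 [sr1 rs1]]]] [Q2 [s2 [r2 [sr2 rs2]]]].
have [Z [i [j [p [q [pi qj pj qi ijpq]]]]]] := ab_biproduct abC Q1 Q2.
have s12 : s1 \oc r2 = 0.
  have -> : s1 \oc r2 = s1 \oc ((r1 \oc s1) \oc (r2 \oc s2)) \oc r2.
    by rewrite !compA sr1 comp1m -!compA sr2 compm1.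
  rewrite rs1 rs2 point_comp fe.
  by apply: lin_ext => a; rewrite !linM pointE scaler0 linear0.
have s21 : s2 \oc r1 = 0.
  have -> : s2 \oc r1 = s2 \oc ((r2 \oc s2) \oc (r1 \oc s1)) \oc r1.
    by rewrite !compA sr2 comp1m -!compA sr1 compm1.
  rewrite rs1 rs2 point_comp ef.
  by apply: lin_ext => a; rewrite !linM pointE scaler0 linear0.
exists Z, (fmap v i \oc s1 + fmap v j \oc s2), (r1 \oc fmap v p + r2 \oc fmap v q).
split.
  rewrite compDl !compDr -!compA ![s1 \oc (_ \oc _)]compA ![s2 \oc (_ \oc _)]compA.
  rewrite sr1 sr2 s12 s21 !comp1m !comp0m !compm0 addr0 add0r -!fmapM.
  by rewrite -(fmapD hX) ijpq fmap1.
rewrite compDl !compDr -!compA ![fmap v p \oc (_ \oc _)]compA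
  ![fmap v q \oc (_ \oc _)]compA -!fmapM pi qj pj qi !fmap1 !(fmap0 hX).
rewrite !comp1m !comp0m !compm0 addr0 add0r rs1 rs2.
by apply: lin_ext => a; rewrite linD !pointE scalerDr.
Qed.

(** A counterexample with minimal left ideal is not zero, so it is the sum of a
minimal idempotent [g] and an idempotent orthogonal to [g] that generates a
smaller ideal; both lift. *)
Lemma lift_idem (e : A) : e * e = e -> lifts e.
Proof.
move=> ee; apply: contrapT => nl.
have [||_ [e0 [e0e0 nl0] <-] emin] := regular_min hA
    (F := [set principal f | f in [set f : A | f * f = f /\ ~ lifts f]]).
- by move=> _ [f _ <-]; exact: principal_submod.
- by exists (principal e), e.
have e0n0 : e0 != 0 by apply/eqP => e00; apply: nl0; rewrite e00; exact: lifts0.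
have [g [mg ge eg]] := exists_min_idem hA e0e0 e0n0; have [gg gn0 _] := mg.
apply: nl0; have -> : e0 = g + (e0 - g) by rewrite addrC subrK.
apply: liftsD; rewrite ?mulrBr ?mulrBl ?ge ?eg ?gg ?subrr //.
  exact: lift_min_idem.
apply: contrapT => nl1.
have hh : (e0 - g) * (e0 - g) = e0 - g.
  by rewrite mulrBl !mulrBr ge eg gg e0e0 subrr subr0.
have sub : principal (e0 - g) `<=` principal e0.
  move=> _ [a _ <-]; exists (a * (e0 - g)) => //.
  by rewrite !rmulE -mulrA mulrBl e0e0 ge.
have E := emin _ (ex_intro2 _ _ (e0 - g) (conj hh nl1) erefl) sub.
have : principal e0 g by exists g.
rewrite -E => -[b _ gE]; case/eqP: gn0.
have gE' : b * (e0 - g) = g := gE.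
have : g * (e0 - g) = g by rewrite -{1}gE' -mulrA hh.
by rewrite mulrBr ge gg subrr.
Qed.

Lemma lift_regular : exists (Q : C) (s : hom R (v Q)) (r : hom (v Q) R),
  s \oc r = idm (v Q) /\ r \oc s = idm R.
Proof.
have [Q [s [r [sr rs]]]] := lift_idem (mulr1 (1 : A)).
exists Q, s, r; split=> //; rewrite rs.
by apply: lin_ext => a; rewrite pointE lin1 /GRing.scale /= mulr1.
Qed.

End Lifting.

(** * The grading and the cover-equivalence *)

Section DirectSums.
Variables (V W : zmodType) (G : int -> {pred W}).

Lemma direct_sum_bij (phi : {additive V -> W}) : bijective phi ->
  is_direct_sum G -> is_direct_sum (fun i => [pred x | phi x \in G i]).
Proof.
move=> [psi phiK psiK] [clG exG].
have psi_add : additive psi.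
  by move=> x y; apply: (can_inj phiK); rewrite raddfB /= !psiK.
have psi0 : psi 0 = 0 by rewrite -(raddf0 phi) phiK.
have phi0 x : (phi x == 0) = (x == 0) by rewrite -[RHS](inj_eq (can_inj phiK)) raddf0.
split=> [i|x].
  split; first by rewrite inE raddf0; have [] := clG i.
  by move=> x y; rewrite !inE raddfB; have [_] := clG i; apply.
have sumE (c : int -> V) : finite_set [set i | c i != 0] ->
    \sum_(i \in [set: int]) phi (c i) = phi (\sum_(i \in [set: int]) c i).
  move=> cfin; have [s us sP] := finite_int_seq cfin.
  by rewrite !(finsum_seq us) ?raddf_sum // => i; rewrite ?phi0 => ?; exact/sP.
have [c [[cG cfin cE] cU]] := exG (phi x).
exists (psi \o c); split; first split=> [i||] /=.
- by rewrite inE /= psiK.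
- apply: sub_finite_set cfin => i /=; apply: contra_neq => ->; exact: psi0.
- apply: (can_inj phiK); rewrite cE -sumE.
    by apply: eq_fsbigr => i _; rewrite /= psiK.
  apply: sub_finite_set cfin => i /=; apply: contra_neq => ->; exact: psi0.
move=> d [dG dfin dE]; apply/funext => i /=; rewrite (cU (phi \o d)) /= ?phiK //.
split=> [j||]; first exact: dG.
  by apply: sub_finite_set dfin => j /=; rewrite phi0.
by rewrite dE -sumE.
Qed.

End DirectSums.

Section Equivalence.
Variables (A : pzRingType) (X : cover_data (modf A)) (hX : graded_cover X).
Local Notation C := (cv_cat X).
Local Notation S := (cv_shift X).
Local Notation v := (cv_fun X).
Local Notation R := (regmod A : obj (modf A)).
Variables (Q : C) (s : hom R (v Q)) (r : hom (v Q) R).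
Hypotheses (sr : s \oc r = idm (v Q)) (rs : r \oc s = idm R).

Lemma of_degree_direct_sum (M N : C) :
  is_direct_sum (fun i => [pred f : hom (v M) (v N) | `[< of_degree i f >]]).
Proof.
split=> [i|f].
  split=> [|f g /asboolP fi /asboolP gi]; apply/asboolP.
    exact: of_degree_zero.
  exact: of_degreeB.
have [c cf] := of_degree_components hX f; exists c; split.
  by case: cf => cD cfin cE; split=> // i; apply/asboolP.
move=> d [dD dfin dE]; apply: (components_uniq hX cf).
by split=> // i; have /asboolP := dD i.
Qed.

(** The elements of [vM] as maps from [vQ], through the isomorphism of [vQ] with [A]. *)
Definition vpoint (M : C) (x : v M) : hom (v Q) (v M) := point x \oc r.

Lemma vpoint_additive M : additive (@vpoint M).
Proof.
move=> x y; apply: lin_ext => a.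
by rewrite linD linN !linM !pointE scalerBr.
Qed.
HB.instance Definition _ M :=
  GRing.isAdditive.Build _ _ (@vpoint M) (@vpoint_additive M).

Lemma vpoint_bij M : bijective (@vpoint M).
Proof.
exists (fun f => lin (f \oc s) (1 : A^o)) => [x|f].
  by rewrite /vpoint -compA rs compm1 pointE scale1r.
by rewrite /vpoint point1 -compA sr compm1.
Qed.

Lemma vpoint_fmap M N (f : hom (v M) (v N)) x : vpoint (lin f x) = f \oc vpoint x.
Proof. by rewrite /vpoint compA comp_point. Qed.

Definition degree_part (M : C) (i : int) : {pred v M} :=
  [pred x | `[< of_degree i (vpoint x) >]].

Arguments degree_part : clear implicits.

Lemma degree_partP M i (x : v M) :
  reflect (of_degree i (vpoint x)) (x \in degree_part M i).
Proof. exact: asboolP. Qed.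

Lemma degree_part_direct M : is_direct_sum (degree_part M).
Proof.
exact: (direct_sum_bij (phi := @vpoint M) (vpoint_bij M) (of_degree_direct_sum Q M)).
Qed.

(** Right multiplication by [a], transported to [vQ]; composition order is
reversed, as in the isomorphism of [A] with the opposite of [End(A)]. *)
Definition rmul_end (a : A) : hom (v Q) (v Q) := s \oc point (a : R) \oc r.

Lemma rmul_end_additive : additive rmul_end.
Proof.
move=> a b; apply: lin_ext => x.
by rewrite linD linN !linM !pointE scalerBr linearB.
Qed.
HB.instance Definition _ := GRing.isAdditive.Build A _ rmul_end rmul_end_additive.

Lemma rmul_end_bij : bijective rmul_end.
Proof.
exists (fun f => lin (r \oc f \oc s) (1 : A^o)) => [a|f].
  rewrite /rmul_end !compA rs comp1m -compA rs compm1 pointE /GRing.scale /=.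
  exact: mul1r.
by rewrite /rmul_end point1 !compA sr comp1m -compA sr compm1.
Qed.

Definition ring_part (i : int) : {pred A} := [pred a | `[< of_degree i (rmul_end a) >]].

Lemma vpoint_scale M a (x : v M) : vpoint (a *: x) = vpoint x \oc rmul_end a.
Proof.
rewrite /vpoint /rmul_end !compA -[point x \oc r \oc s]compA rs compm1 comp_point.
by rewrite pointE.
Qed.

Lemma rmul_end1 : rmul_end 1 = idm (v Q).
Proof.
have -> : rmul_end 1 = s \oc idm R \oc r; last by rewrite compm1.
rewrite /rmul_end; congr (_ \oc _ \oc _).
by apply: lin_ext => a; rewrite pointE lin1 /GRing.scale /= mulr1.
Qed.

Lemma rmul_endM a b : rmul_end (a * b) = rmul_end b \oc rmul_end a.
Proof.
rewrite /rmul_end !compA -[s \oc _ \oc r \oc s]compA rs compm1.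
by rewrite -[s \oc _ \oc point _]compA point_comp.
Qed.

Definition cover_grading : grading A.
Proof.
refine (@Grading A ring_part _ _ _).
- exact: (direct_sum_bij (phi := rmul_end) rmul_end_bij (of_degree_direct_sum Q Q)).
- by apply/asboolP; rewrite rmul_end1; exact: of_degree1.
- move=> i j a b /asboolP ai /asboolP bj; apply/asboolP.
  by rewrite rmul_endM; exact: of_degreeM bj ai.
Defined.

Fact degree_part_grading M : is_module_grading cover_grading (degree_part M).
Proof.
split; first exact: degree_part_direct.
move=> i j a x /asboolP ai /degree_partP xj; apply/degree_partP.
by rewrite vpoint_scale; exact: of_degreeM xj ai.
Qed.

(** The underlying module is [vM] itself, so that forgetting the grading gives
[v] back and the comparison isomorphism can be the identity. *)
Definition regrade (M : C) : grmod cover_grading := GrMod (degree_part_grading M).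

Fact regrade_homogeneous M N (f : @hom C M N) :
  lin (fmap v f) \in @homogeneous A cover_grading (regrade M) (regrade N).
Proof.
apply/asboolP => j x /degree_partP xj; apply/degree_partP; rewrite vpoint_fmap.
by apply: of_degreeM (of_degree_fmap f) xj; rewrite addr0.
Qed.

Definition regrade_hom M N (f : @hom C M N) : grhom (regrade M) (regrade N) :=
  GrHom (regrade_homogeneous f).

Definition regrade_functor : functor C (grmodf cover_grading).
Proof.
refine (@Functor C (grmodf cover_grading) regrade regrade_hom _ _).
- by move=> M; apply/val_inj; exact: (fmap1 v).
- by move=> M N P g f; apply/val_inj; exact: (fmapM v).
Defined.

Lemma regrade_additive : additive_functor regrade_functor.
Proof. by move=> M N f g; apply/val_inj; exact: (fmapD hX). Qed.

Fact regrade_eps_homogeneous M :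
  lin (eps_hom M) \in @homogeneous A cover_grading
    (shift_obj 1 (regrade M)) (regrade (S M)).
Proof.
apply/asboolP => j x /degree_partP xj; apply/degree_partP; rewrite vpoint_fmap.
by apply: of_degreeM (of_degree_eps M) xj; rewrite addrAC subrr add0r.
Qed.

Fact regrade_eps_inv_homogeneous M :
  lin (eps_inv M) \in @homogeneous A cover_grading
    (regrade (S M)) (shift_obj 1 (regrade M)).
Proof.
apply/asboolP => j x /degree_partP xj; apply/degree_partP; rewrite vpoint_fmap.
by apply: of_degreeM (of_degree_eps_inv M) xj; rewrite addrC.
Qed.

Definition regrade_eps :
  nat_iso (grshift1 cover_grading \of regrade_functor) (regrade_functor \of S).
Proof.
refine (@NatIso _ _ (grshift1 cover_grading \of regrade_functor) (regrade_functor \of S)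
  (fun M => GrHom (regrade_eps_homogeneous M))
  (fun M => GrHom (regrade_eps_inv_homogeneous M)) _ _ _).
- by move=> M; apply/val_inj; exact: (epsK M).
- by move=> M; apply/val_inj; exact: (epsVK M).
- by move=> M N f; apply/val_inj; exact: (eps_nat f).
Defined.

Definition regrade_pi :
  nat_iso (cv_fun (grmodf_cover cover_grading) \of regrade_functor) v.
Proof.
refine (@NatIso _ _ (cv_fun (grmodf_cover cover_grading) \of regrade_functor) v
  (fun M => idm (v M)) (fun M => idm (v M)) _ _ _).
- by move=> M; exact: comp1m.
- by move=> M; exact: comp1m.
- by move=> M N f; rewrite comp1m compm1.
Defined.

Lemma regrade_equivalence : cover_equivalence X (grmodf_cover cover_grading).
Proof.
refine (@CoverEquivalence _ X (grmodf_cover cover_grading)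
  regrade_functor regrade_additive
  regrade_eps regrade_pi _).
by move=> M; apply: lin_ext.
Qed.

End Equivalence.

Theorem proposition5p1 (A : pzRingType) (hA : left_artinian A)
    (X : cover_data (modf A)) (hX : graded_cover X) :
  exists G : grading A, cover_equivalent (grmodf_cover G) X.
Proof.
have [Q [s [r [sr rs]]]] := lift_regular hA hX.
exists (cover_grading hX sr rs); right; constructor.
exact: regrade_equivalence.
Qed.
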